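(* For every fixed integer $r\ge 3$, the problem Weak $r$-Orderable, parameterized by the natural parameter $k$, is para-NP-hard. In particular, deciding whether $\mathrm{wcol}_r(G)\le k$ is NP-hard already for $k=2r-1$.
   Context: Weak $r$-Orderable: given a graph $G=(V,E)$ and an integer $k$, decide whether $\mathrm{wcol}_r(G)\le k$. For a total order $\sigma$ of $V$, a vertex $v\neq u$ is weakly $r$-reachable from $u$ if $u <_\sigma v$ and there is a $u$–$v$ path of length at most $r$ all of whose vertices other than $u,v$ precede $v$ in $\sigma$; $\mathrm{wreach}_r(u,G_\sigma)$ is the set of such $v$, and $\mathrm{wcol}_r(G)=\min_\sigma\max_u|\mathrm{wreach}_r(u,G_\sigma)|$ over all total orders $\sigma$ of $V$. A parameterized problem is para-NP-hard if it is NP-hard for some fixed constant value of the parameter. *)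

(* Defs.v *)
From mathcomp Require Import all_boot all_fingroup.
Set Implicit Arguments. Unset Strict Implicit. Unset Printing Implicit Defensive.

Record graph := Graph {
  gv : nat;
  gadj : rel 'I_gv;
  gadj_sym : symmetric gadj;
  gadj_irr : irreflexive gadj }.

(* A total order sigma of V is given by a bijection s : V -> {0..n-1}
   (a permutation of 'I_n); u <_sigma v  iff  s u < s v. *)

Definition wreachable (G : graph) (r : nat) (s : {perm 'I_(gv G)})
    (u v : 'I_(gv G)) : bool :=
  [&& v != u, s u < s v &
   [exists l : 'I_r.+1, exists f : {ffun 'I_r.+1 -> 'I_(gv G)},
     [&& f ord0 == u, f (inord l) == v,
         [forall i : 'I_r.+1, (i < l) ==> @gadj G (f i) (f (inord i.+1))] &
         [forall i : 'I_r.+1, (0 < i < l) ==> (s (f i) < s v)]]]].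

Definition wreach (G : graph) (r : nat) (s : {perm 'I_(gv G)}) (u : 'I_(gv G))
  : {set 'I_(gv G)} := [set v | wreachable r s u v].

(* wcol_r(G) = min over orders of max over u of |wreach_r(u)|.
   (gv G is a valid neutral element for minn since every |wreach| < gv G.) *)
Definition wcol (r : nat) (G : graph) : nat :=
  \big[minn/gv G]_(s : {perm 'I_(gv G)}) \max_(u : 'I_(gv G)) #|wreach r s u|.

(* Complexity theory: deterministic single-tape Turing machines        *)
(* over the tape alphabet option bool (None = blank).                  *)
Inductive move := MoveL | MoveR | MoveS.

Record TM := mkTM {
  tm_nq : nat;
  tm_start : 'I_tm_nq.+1;
  tm_halt : 'I_tm_nq.+1 -> bool;
  tm_acc : 'I_tm_nq.+1 -> bool;
  tm_delta : 'I_tm_nq.+1 -> option bool -> 'I_tm_nq.+1 * option bool * move }.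

(* configuration: state, left part (nearest cell first), head cell, right part *)
Record config (M : TM) := Config {
  c_state : 'I_(tm_nq M).+1;
  c_left : seq (option bool);
  c_cur : option bool;
  c_right : seq (option bool) }.

Definition step (M : TM) (c : config M) : config M :=
  let: Config q l a rt := c in
  if @tm_halt M q then c else
  let: (q', b, m) := @tm_delta M q a in
  match m with
  | MoveS => @Config M q' l b rt
  | MoveL => match l with
             | [::] => @Config M q' [::] None (b :: rt)
             | x :: l' => @Config M q' l' x (b :: rt)
             end
  | MoveR => match rt with
             | [::] => @Config M q' (b :: l) None [::]
             | x :: rt' => @Config M q' (b :: l) x rt'
             end
  end.

Definition run (M : TM) (t : nat) (c : config M) : config M := iter t (@step M) c.

Definition init_tape (M : TM) (w : seq (option bool)) : config M :=
  @Config M (tm_start M) [::] (head None w) (behead w).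

Definition halted (M : TM) (c : config M) : bool := @tm_halt M (c_state c).

Fixpoint read_word (s : seq (option bool)) : seq bool :=
  match s with Some b :: s' => b :: read_word s' | _ => [::] end.
Definition output (M : TM) (c : config M) : seq bool :=
  read_word (c_cur c :: c_right c).

Definition poly_bound (c d n : nat) : nat := c * n ^ d + c.

Definition poly_time_computable (f : seq bool -> seq bool) : Prop :=
  exists (M : TM) (c d : nat), forall x : seq bool,
    exists t, t <= poly_bound c d (size x) /\
      halted (run t (init_tape M (map Some x))) /\
      output (run t (init_tape M (map Some x))) = f x.

Definition verifier_input (x y : seq bool) : seq (option bool) :=
  map Some x ++ None :: map Some y.

Definition in_NP (L : seq bool -> Prop) : Prop :=
  exists (M : TM) (c d : nat),
    (forall x y, exists t, t <= poly_bound c d (size x + size y) /\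
        halted (run t (init_tape M (verifier_input x y)))) /\
    (forall x, L x <-> exists y, size y <= poly_bound c d (size x) /\
        exists t, halted (run t (init_tape M (verifier_input x y))) /\
                  @tm_acc M (c_state (run t (init_tape M (verifier_input x y))))).

Definition NP_hard (L : seq bool -> Prop) : Prop :=
  forall L' : seq bool -> Prop, in_NP L' ->
    exists f, poly_time_computable f /\ forall x, L' x <-> L (f x).

Definition enc_graph (G : graph) : seq bool :=
  nseq (gv G) true ++ false ::
    [seq @gadj G i j | i <- enum 'I_(gv G), j <- enum 'I_(gv G)].

Definition enc_inst (G : graph) (k : nat) : seq bool :=
  nseq k true ++ false :: enc_graph G.

Definition slice_lang (P : graph -> nat -> Prop) (k : nat) : seq bool -> Prop :=
  fun x => exists G, x = enc_inst G k /\ P G k.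

Definition para_NP_hard (P : graph -> nat -> Prop) : Prop :=
  exists k, NP_hard (slice_lang P k).

Definition weak_r_orderable (r : nat) : graph -> nat -> Prop :=
  fun G k => wcol r G <= k.

(* Main.v *)
(** NP-hardness for k = 2r - 1 by a reduction from satisfiability.  A variable becomes an edge between a
    true end and a false end, and an ordering assigns to it the value of its higher end.  A clause with
    2r - 3 literals becomes a hub joined by paths of length r - 1 to the ends that represent its literals.
    When all these paths lie below the ends they lead to, the hub weakly reaches one end per literal, and
    both ends exactly when the literal is false; hence it reaches at most 2r - 1 vertices if and only if at
    most two literals are false.  Each hub is copied so often that in every good ordering some copy has all
    its paths low.  Three of the literals form a 3-clause and the others are dummies.

    For an arbitrary language in NP, the 3-clauses describe the space-time diagram of the verifier: its
    transition rule is local, and the certificate is guessed in the initial row.  The adjacency matrix of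
    the resulting graph is given by arithmetic conditions on the coordinates of the vertices, and is
    printed by nested loops, which are compiled to a stack machine and from there to a Turing machine. *)
From Stdlib Require Import ZArith FunctionalExtensionality.
From mathcomp Require Import all_boot all_fingroup zify.
Require Import Defs.
Set Implicit Arguments. Unset Strict Implicit. Unset Printing Implicit Defensive.

(** * The graph of an edge relation and its orderings *)

(** With [r = e + 2] an arm has [e] inner vertices, so a hub is at distance [r - 1] from the ends
    that represent its literals, the ports, and at distance exactly [r] from the opposite ends, the
    mates. The bound [k = 2r - 1] is the number of ports plus the two false literals that a clause
    may have. Three proper literals thus express a 3-clause, and the true dummies only adjust the
    number of ports to [k - 2]; for [r = 3] there are none. An ordering may spoil a copy by lifting
    a vertex of an arm above its port, but the port then reaches such a vertex in every copy spoilt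
    on this arm, so at most [k] copies are lost per arm. Conversely, a satisfying assignment must
    yield an ordering in which all vertices reach few others, and this rests on lower bounds for
    distances in the graph.

    The other obstacle is that the reduction has to run on a single-tape machine. The vertices
    therefore form a fixed finite set of kinds times a square grid, of which only the side depends
    on the input, and adjacency is given by one fixed expression for each pair of kinds. *)

Lemma nth_belast (T : Type) (x0 x : T) s i :
  i < size s -> nth x0 (belast x s) i = nth x0 (x :: s) i.
Proof. by move=> si; rewrite lastI nth_rcons size_belast si. Qed.

Lemma bigminn_leq (I : eqType) (n : nat) (s : seq I) (F : I -> nat) i :
  i \in s -> \big[minn/n]_(j <- s) F j <= F i.
Proof.
elim: s => // j s IH; rewrite inE big_cons => /orP[/eqP->|/IH]; first exact: geq_minl.
exact: leq_trans (geq_minr _ _).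
Qed.

Section Orders.
Variables (V : finType) (e : rel V).

(** The order is given by a rank instead of a permutation, so that it can be built from heights. The
    list [p] is a walk without its start and may repeat vertices; since [belast u p] omits only the
    last vertex, the condition on it covers exactly the start and the interior. *)
Definition reach (r : nat) (rk : V -> nat) (u v : V) : Prop :=
  rk u < rk v /\ exists p : seq V,
    [/\ path e u p, last u p = v, size p <= r
      & all (fun w => rk w < rk v) (belast u p)].

Hypotheses (e_sym : symmetric e) (e_irr : irreflexive e).

Definition graph_of : graph :=
  @Graph #|V| (fun i j => e (enum_val i) (enum_val j))
    (fun i j => e_sym _ _) (fun i => e_irr _).

Lemma wreachableP r (s : {perm 'I_(gv graph_of)}) (u v : 'I_(gv graph_of)) :
  reflect (reach r (fun x => s (enum_rank x)) (enum_val u) (enum_val v))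
          (wreachable r s u v).
Proof.
apply: (iffP and3P) => [[vu suv /existsP[l /existsP[f /and4P[/eqP f0 /eqP fl]]]]|].
  move=> /forallP fe /forallP flt; split; first by rewrite !enum_valK.
  pose g i := enum_val (f (inord i)) : V.
  exists [seq g i | i <- iota 1 l].
  have g0 : enum_val u = g 0 by rewrite /g -f0; congr (enum_val (f _)); apply: val_inj; rewrite /= inordK.
  have Hlast m : last (g 0) [seq g i | i <- iota 1 m] = g m.
    by rewrite last_map; congr g; elim: m => // m IH; rewrite -(addn1 m) iotaD last_cat /= add1n addn1.
  split.
  - rewrite g0.
    have: l <= r by rewrite -ltnS.
    have: (l <= l)%N by [].
    move: {1 3 4}(nat_of_ord l) => m; elim: m => // m IH mr mr'.
    rewrite -(addn1 m) iotaD map_cat cat_path IH /= ?andbT ?Hlast; try lia.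
    have lm : m < r.+1 by lia.
    have := fe (inord m); rewrite inordK // mr /=.
    by rewrite /g add1n.
  - by rewrite g0 Hlast /g fl.
  - by rewrite size_map size_iota -ltnS.
  - rewrite g0; apply/(all_nthP (g 0)) => i.
    rewrite size_belast size_map size_iota => il.
    have -> : nth (g 0) (belast (g 0) [seq g i | i <- iota 1 l]) i = g i.
      rewrite nth_belast ?size_map ?size_iota //; case: i il => //= i il.
      by rewrite (nth_map 0) ?size_iota ?nth_iota; try lia.
    have ir : i < r.+1 by case: l il {fl fe flt Hlast} => /= m; lia.
    rewrite /g !enum_valK; have [->|i0] := posnP i.
      suff -> : inord 0 = ord0 :> 'I_r.+1 by rewrite f0.
      by apply: val_inj; rewrite /= inordK.
    by have := flt (inord i); rewrite inordK // i0 il.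
case; rewrite !enum_valK => suv [p [ep lp sp ap]].
split=> //; first by apply: contraTneq suv => ->; rewrite ltnn.
apply/existsP; exists (inord (size p)); apply/existsP.
pose f : {ffun 'I_r.+1 -> 'I_(gv graph_of)} :=
  [ffun i => enum_rank (nth (enum_val v) (enum_val u :: p) (nat_of_ord i))].
have fE i : i <= r -> f (inord i) = enum_rank (nth (enum_val v) (enum_val u :: p) i).
  by move=> ir; rewrite ffunE inordK.
exists f; apply/and4P; split.
- by rewrite ffunE /= enum_valK.
- have -> : inord (nat_of_ord (inord (size p) : 'I_r.+1)) = inord (size p) :> 'I_r.+1 by rewrite inord_val.
  by rewrite fE // nth_last /= lp enum_valK.
- apply/forallP=> i; rewrite inordK //; apply/implyP => ip.
  have ir : i < r by lia.
  rewrite fE // ffunE /graph_of /= !enum_rankK.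
  by move/(pathP (enum_val v)): ep => /(_ i ip) /=.
- apply/forallP=> i; rewrite inordK //; apply/implyP => /andP[i0 ip].
  rewrite ffunE; move/(all_nthP (enum_val v)): ap => /(_ i).
  rewrite size_belast => /(_ ip).
  by rewrite nth_belast // enum_rankK.
Qed.

(** As [reach] is a proposition, the bound is stated for all sets of reached vertices. A rank
    becomes a permutation by counting the vertices of smaller rank. *)
Lemma wcol_leP r k : reflect
   (exists2 rk : V -> nat, injective rk & forall (u : V) (S : {set V}),
       (forall v, v \in S -> reach r rk u v) -> #|S| <= k)
   (wcol r graph_of <= k).
Proof.
have HS (s : {perm 'I_(gv graph_of)}) (u : V) (S : {set V}) :
    (forall v, v \in S -> reach r (fun x => s (enum_rank x)) u v) ->
    #|S| <= \max_(u : 'I_(gv graph_of)) #|wreach r s u|.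
  move=> SR; apply: leq_trans (leq_bigmax (enum_rank u)).
  rewrite -(card_imset _ enum_rank_inj); apply/subset_leq_card/subsetP => i.
  case/imsetP => v vS ->; rewrite inE; apply/wreachableP; rewrite !enum_rankK.
  exact: SR.
apply: (iffP idP) => [|[rk rk_inj H]].
  rewrite /wcol => wk.
  (* A minimum at most [k] comes from some order or from the neutral element [gv]; in the second
     case [k] bounds the size of every set of vertices, and any order will do. *)
  have [[s sk]|gk] : (exists s : {perm 'I_(gv graph_of)},
      \max_(u : 'I_(gv graph_of)) #|wreach r s u| <= k) \/ gv graph_of <= k.
    move: wk; apply: (big_ind (fun x => x <= k -> _)).
    - by right.
    - by move=> x y Hx Hy; rewrite geq_min => /orP[]; auto.
    - by move=> s _ sk; left; exists s.
  - exists (fun x => nat_of_ord (s (enum_rank x))).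
      by move=> x y /val_inj /perm_inj /enum_rank_inj.
    by move=> u S SR; apply: leq_trans (HS _ _ _ SR) sk.
  - exists (fun x => nat_of_ord (enum_rank x)); first by move=> x y /val_inj /enum_rank_inj.
    by move=> u S _; apply: leq_trans (max_card _) gk.
pose low (i : 'I_#|V|) := [set v | rk v < rk (enum_val i)] : {set V}.
have lowP i : #|low i| < #|V|.
  rewrite -cardsT; apply/proper_card/properP; split; first exact: subsetT.
  by exists (enum_val i); rewrite ?inE ?ltnn.
pose f i := Ordinal (lowP i) : 'I_(gv graph_of).
have f_lt i j : (f i < f j) = (rk (enum_val i) < rk (enum_val j)).
  have lt i' j' : rk (enum_val i') < rk (enum_val j') -> f i' < f j'.
    move=> ij; apply/proper_card/properP; split.
      by apply/subsetP => v; rewrite !inE => /ltn_trans; apply.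
    by exists (enum_val i'); rewrite !inE ?ltnn.
  apply/idP/idP; last exact: lt.
  apply: contraTT; rewrite -leqNgt leq_eqVlt => /orP[/eqP/rk_inj/enum_val_inj->|/lt].
    by rewrite ltnn.
  by rewrite -leqNgt => /ltnW.
have f_inj : injective f.
  move=> i j fij; apply: enum_val_inj; apply: rk_inj.
  by have := f_lt i j; have := f_lt j i; rewrite fij ltnn; case: ltngtP.
apply: (@leq_trans (\max_(u : 'I_(gv graph_of)) #|wreach r (perm f_inj) u|)).
  exact: bigminn_leq (mem_index_enum _).
apply/bigmax_leqP => u _.
rewrite -(card_imset _ enum_val_inj); apply: (H (enum_val u)) => v.
case/imsetP => w; rewrite inE => /wreachableP.
have rkE x y : (perm f_inj (enum_rank x) < perm f_inj (enum_rank y)) = (rk x < rk y).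
  by rewrite !permE f_lt !enum_rankK.
case; rewrite rkE => uw [p [ep lp sp ap]] ->; split=> //; exists p; split=> //.
by apply: sub_all ap => x; rewrite rkE.
Qed.
End Orders.

(** * The clause gadget *)

Section Gadget.
Variables (e : nat) (VK CK Z : finType).

Notation A := (2 * e).+1.
Notation k := (2 * e).+3.

(** Each of the [A] arms can be spoilt in at most [k] copies, so one copy remains intact; see
    [low_copy]. *)
Definition copies := (A * k).+1.
(* Left: the two ends of a variable edge.  Right: in a copy of a clause, [None] is the hub and
   [Some (i, d)] is the vertex at distance [d.+1] from the end of arm [i]. *)
Definition kind : finType :=
  (VK * bool + (CK * 'I_copies) * option ('I_A * 'I_e))%type.
Definition vert : finType := (kind * Z)%type.

Variables (act : CK -> Z -> bool) (lit : CK -> Z -> 'I_A -> (VK * Z) * bool).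

Definition var (x : VK * Z) (s : bool) : vert := (inl (x.1, s), x.2).
Definition node c m z (o : option ('I_A * 'I_e)) : vert := (inr (c, m, o), z).

Definition half_adj (u v : vert) : bool :=
  match u, v with
  | (inl (x, s), z), (inl (x', s'), z') => [&& x == x', z == z' & s != s']
  | (inl (x, s), z), (inr (c, m, Some (i, d)), z') =>
      [&& d == 0 :> nat, act c z' & lit c z' i == ((x, z), s)]
  | (inr (c, m, Some (i, d)), z), (inr (c', m', Some (i', d')), z') =>
      [&& c == c', m == m', z == z', i == i' & d.+1 == d']
  | (inr (c, m, Some (i, d)), z), (inr (c', m', None), z') =>
      [&& c == c', m == m', z == z' & d.+1 == e]
  | _, _ => false
  end.

Definition adj (u v : vert) : bool := half_adj u v || half_adj v u.

Lemma adj_sym : symmetric adj.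
Proof. by move=> u v; rewrite /adj orbC. Qed.

Lemma adj_irr : irreflexive adj.
Proof.
move=> [[[x s]|[[c m] [[i d]|]]] z]; rewrite /adj orbb //=; first by rewrite !eqxx.
by rewrite [_.+1 == _]gtn_eqF ?andbF.
Qed.

Definition gadget_graph : graph := graph_of adj_sym adj_irr.

Hypothesis e_gt0 : 0 < e.
Hypothesis lit_inj : forall c z, act c z -> injective (fun i => (lit c z i).1).

(** * From an assignment to an ordering *)

Section Upper.
Variable asg : VK * Z -> bool.
Hypothesis asg_sat : forall c z, act c z ->
  #|[set i | asg (lit c z i).1 != (lit c z i).2]| <= 2.

(** Heights grow along an arm towards the hub, and the hub lies below all ends of variables. Hence
    arms lead from the hub to ends that are higher, while no vertex of an arm is reached across the
    hub. *)
Definition height (u : vert) : nat :=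
  match u with
  | (inl (x, s), z) => if asg (x, z) == s then e.+2 else e.+1
  | (inr (_, _, Some (_, d)), _) => d
  | (inr (_, _, None), _) => e
  end.

Definition hrank (u : vert) : nat := height u * #|vert| + enum_rank u.

Lemma hrank_inj : injective hrank.
Proof.
move=> u v /(congr1 (modn^~ #|vert|)); rewrite /hrank !modnMDl !modn_small ?ltn_ord //.
by move=> /val_inj /enum_rank_inj.
Qed.

Lemma hrank_height u v : hrank u < hrank v -> height u <= height v.
Proof.
rewrite /hrank; have := ltn_ord (enum_rank u); have := ltn_ord (enum_rank v).
move: (nat_of_ord _) (nat_of_ord _) => a b.
by move: #|vert| (height u) (height v) => n x y; nia.
Qed.

(* A lower bound for the distance to [var x s]; when [bl] holds, the other end of the variable edge is deleted. *)
Section Potential.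
Variables (bl : bool) (x : VK * Z) (s : bool).

Definition hits c z i : bool :=
  [&& act c z, (lit c z i).1 == x & ((lit c z i).2 == s) || ~~ bl].
Definition side (s' : bool) : nat := s' != s.
(** At most one arm of an active clause is hit, because its literals have distinct variables, so
    [pick] involves no choice. The default [(2 * e).+2] is the length of the way from one port to
    another through the hub; it exceeds the radius [e.+2] and serves as the value of everything far
    away. *)
Definition hub c z : nat :=
  if [pick i | hits c z i] is Some i then side (lit c z i).2 + e.+1 else (2 * e).+2.
Definition potential (u : vert) : nat :=
  match u with
  | (inl (y, s'), z) => if (y, z) == x then side s' else (2 * e).+2
  | (inr (c, m, Some (i, d)), z) =>
      if hits c z i then side (lit c z i).2 + d.+1
      else if [exists j, hits c z j] then hub c z + e - d else (2 * e).+2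
  | (inr (c, m, None), z) => hub c z
  end.

Lemma hubE c z i : hits c z i -> hub c z = side (lit c z i).2 + e.+1.
Proof.
move=> hi; rewrite /hub; case: pickP => [j hj|/(_ i)]; last by rewrite hi.
case/and3P: hi => ac /eqP li _; case/and3P: hj => _ /eqP lj _.
by have -> : j = i by apply: (lit_inj ac); rewrite li lj.
Qed.

Lemma hub_none c z : [exists j, hits c z j] = false -> hub c z = (2 * e).+2.
Proof. by move=> /existsP H; rewrite /hub; case: pickP => // i hi; case: H; exists i. Qed.

Lemma hub_some c z : [exists j, hits c z j] -> e.+1 <= hub c z <= e.+2.
Proof. by move=> /existsP[i /hubE->]; rewrite /side; case: (_ != _); lia. Qed.

(** The potential changes by at most one along every edge that avoids the deleted end, which makes
    it a lower bound for the distance to a vertex of potential 0. *)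
Lemma potential_half u v : half_adj u v ->
  (bl -> u <> var x (~~ s) /\ v <> var x (~~ s)) ->
  potential u <= (potential v).+1 /\ potential v <= (potential u).+1.
Proof.
case: u => [[[y t]|[[c m] [[i d]|]]] z]; case: v => [[[y' t']|[[c' m'] [[i' d']|]]] z'] //=.
- case/and3P => /eqP<- /eqP<- _ _; case: eqP => _; last by lia.
  by rewrite /side; case: (_ != _); case: (_ != _).
- case/and3P => /eqP d0 ac /eqP li av.
  case: (boolP (hits c' z' i')) => [hi|nhi].
    case/and3P: hi => _ /eqP lx _; rewrite -lx li eqxx /= d0; lia.
  (* An arm of [x] that is not hit starts at the deleted end, which the hypothesis excludes. *)
  case: eqP => [yx|_].
    have := nhi; rewrite /hits ac li /= yx eqxx /= negb_or negbK => /andP[ts b].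
    case: (av b) => + _; case.
    by rewrite /var -yx /=; move: ts; case: (t) (s) => -[].
  case: ifP => // /hub_some; lia.
- case/and5P => /eqP<- /eqP<- /eqP<- /eqP<- /eqP dd _; rewrite -dd.
  have := ltn_ord d'; rewrite -dd => de.
  case: (boolP (hits c z i)) => [hi|nhi]; first by lia.
  by case: ifP => // /hub_some; lia.
- case/and4P => /eqP<- /eqP<- /eqP<- /eqP dd _.
  case: (boolP (hits c z i)) => [hi|nhi]; first by rewrite (hubE hi); lia.
  by case: ifP => [|/hub_none->]; lia.
Qed.

Lemma potential_adj u v : adj u v ->
  (bl -> u <> var x (~~ s) /\ v <> var x (~~ s)) -> potential u <= (potential v).+1.
Proof.
case/orP => /potential_half H av; first by case: (H av).
by case: H => // b; case: (av b).
Qed.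

Lemma potential_path u p : path adj u p -> last u p = var x s ->
  (bl -> var x (~~ s) \notin u :: p) -> potential u <= size p.
Proof.
elim: p u => [|v p IH] u /=.
  by move=> _ -> _; rewrite /= -surjective_pairing eqxx /side eqxx.
case/andP => uv vp lp av; apply: leq_trans (potential_adj uv _) _.
  by move=> b; have := av b; rewrite !inE !negb_or => /and3P[/eqP + /eqP + _]; split; apply/nesym.
by rewrite ltnS; apply: IH => // b; have := av b; rewrite inE negb_or => /andP[].
Qed.
End Potential.

(** If [var x s] is the lower end of its edge, a walk that reaches it weakly avoids the higher end;
    this is the situation described by [bl]. *)
Lemma reach_var u x s : reach adj e.+2 hrank u (var x s) ->
  potential (asg x != s) x s u <= e.+2.
Proof.
case=> uv [p [up lp sp ap]]; apply: leq_trans sp; apply: potential_path => // bl.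
apply/negP; rewrite lastI lp mem_rcons inE => /orP[/eqP[]|].
  by case: (s).
move/(allP ap)/hrank_height; rewrite /= -surjective_pairing (negPf bl).
have -> : asg x == ~~ s by move: bl; case: (asg x); case: (s).
  by rewrite ltnn.
Qed.

Lemma reach_below u v : reach adj e.+2 hrank u v -> height v <= e ->
  exists c m z o o', [/\ u = node c m z o, v = node c m z o' &
    forall i d, o' = Some (i, d) -> exists d', o = Some (i, d')].
Proof.
case=> uv [p [up lp _ ap]] hv; have {uv} hu := hrank_height uv.
have {ap} : all (fun w => height w <= height v) (belast u p).
  by apply: sub_all ap => w /hrank_height.
elim: p u up lp hu => [|w p IH] u /=.
  move=> _ uv _; move: hv; rewrite -{}uv => hv _; case: u hv => [[[x s]|[[c m] o]] z] /=; first by case: ifP; lia.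
  by exists c, m, z, o, o; split=> // i d ->; exists d.
case/andP => uw wp lp hu /andP[_ ap].
have hw : height w <= height v.
  by case: p wp lp ap {IH} => [|w' p] /= _; [move=> -> | move=> _ /andP[]].
case: (IH w wp lp hw ap) => c [m [z [o [o' [wE vE H]]]]].
have hue : height u <= e by lia.
rewrite wE in uw; rewrite vE in hu; move: uw hu hue => {wE wp lp ap IH}.
case: u => [[[x s]|[[c' m'] o'']] z'] /=; first by case: (_ == _); lia.
rewrite /adj vE.
case: o'' o H => [[i'' d'']|] [[i d]|] H //=; rewrite ?orbF ?orFb.
- move=> /orP[] /and5P[/eqP<- /eqP<- /eqP<- /eqP ii _] _ _; do 5!eexists; split; try by [].
    by move=> i0 d0 /H[d' [? _]]; subst; eexists.
  by move=> i0 d0 /H[d' [? _]]; subst; eexists.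
- case/and4P => /eqP<- /eqP<- /eqP<- _ _ _.
  by do 5!eexists; split; try by []; move=> i0 d0 /H[].
- case/and4P => /eqP<- /eqP<- /eqP<- _ hv' _.
  exists c, m, z, None, o'; split=> // i0 d0 o'E; move: hv'; rewrite o'E /=.
  by have := ltn_ord d0; lia.
Qed.

Lemma hub_reach bl x s c z : hub bl x s c z <= e.+2 ->
  exists i, hits bl x s c z i /\ hub bl x s c z = side s (lit c z i).2 + e.+1.
Proof.
case: (boolP [exists j, hits bl x s c z j]) => [/existsP[i hi] _|/negPf/hub_none->].
  by exists i; split=> //; apply: hubE.
by lia.
Qed.

Definition port c z i : vert := var (lit c z i).1 (lit c z i).2.
Definition mate c z i : vert := var (lit c z i).1 (~~ (lit c z i).2).

Lemma hits_port bl x s c z i : hits bl x s c z i ->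
  var x s = port c z i \/ ~~ bl /\ var x s = mate c z i.
Proof.
case/and3P => _ /eqP xE; rewrite /port /mate -xE => /orP[/eqP->|b]; first by left.
case: (boolP (s == (lit c z i).2)) => [/eqP->|sn]; [by left | right; split=> //].
by congr var; move: sn; case: s; case: (lit c z i).2.
Qed.

(** A mate is reached through its port only if it is the higher end, that is, if the literal is
    false. This leaves [A] ports and at most two mates. *)
Lemma hub_wreach_card c m z (S : {set vert}) :
  (forall v, v \in S -> reach adj e.+2 hrank (node c m z None) v) -> #|S| <= k.
Proof.
move=> SR; case: (set_0Vmem S) => [->|[v0 v0S]]; first by rewrite cards0.
have S_hits v : v \in S -> act c z /\ exists i, v = port c z i \/
     v = mate c z i /\ asg (lit c z i).1 != (lit c z i).2.
  move=> /SR vR; have [hv|hv] := leqP (height v) e.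
    case: (reach_below vR hv) => c' [m' [z' [o [o' [[<- <- <- <-] vE H]]]]].
    case: vR; rewrite vE; case: o' H {vE} => [[i d] /(_ _ _ erefl) [d' //]|].
    by rewrite ltnn.
  case: v hv vR => [[[x s]|[[c' m'] [[i d]|]]] z'] /=; last by lia.
    move=> _ vR; have /hub_reach[i [hi _]] := @reach_var _ (x, z') s vR.
    split; first by case/and3P: hi.
    exists i; case: (hits_port hi) => [vE|[bl vE]]; [by left | right; split=> //].
    case/and3P: hi => _ /eqP lx _; move: bl; case: vE => _ -> _; rewrite lx.
    by case: (asg _); case: (lit c z i).2.
  by have := ltn_ord d; lia.
have ac : act c z by case: (S_hits v0 v0S).
pose F := [set i | asg (lit c z i).1 != (lit c z i).2].
have SF : S \subset [set port c z i | i in 'I_A] :|: [set mate c z i | i in F].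
  apply/subsetP => v /S_hits[_ [i [->|[-> Fi]]]]; rewrite inE; apply/orP; [left|right].
    exact: imset_f.
  by apply: imset_f; rewrite inE.
apply: leq_trans (subset_leq_card SF) _.
apply: leq_trans (leq_card_setU _ _) _.
apply: (@leq_trans (A + 2)); last by lia.
apply: leq_add; first by apply: leq_trans (leq_imset_card _ _) _; rewrite card_ord.
exact: leq_trans (leq_imset_card _ _) (asg_sat ac).
Qed.

(** Only the arm vertex next to the hub is near enough to the other ports, at distance exactly
    [e.+2], and then no other vertex of its arm is at least as high. All remaining arm vertices see
    at most their own arm, port and mate, and the hub. *)
Lemma arm_wreach_card c m z i d (S : {set vert}) :
  (forall v, v \in S -> reach adj e.+2 hrank (node c m z (Some (i, d))) v) -> #|S| <= k.
Proof.
move=> SR.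
pose T0 := [set mate c z i; node c m z None].
pose T := if d.+1 == e then [set port c z j | j in 'I_A]
          else port c z i |: [set node c m z (Some (i, d')) | d' in 'I_e].
have TC : #|T0 :|: T| <= k.
  apply: leq_trans (leq_card_setU _ _) _; apply: (@leq_trans (2 + A)); last by lia.
  apply: leq_add; first by rewrite cards2; case: (_ != _).
  rewrite /T; case: ifP => de.
    by apply: leq_trans (leq_imset_card _ _) _; rewrite card_ord.
  apply: leq_trans (leq_card_setU _ _) _; apply: (@leq_trans (1 + e)); last by lia.
  by rewrite cards1 leq_add2l; apply: leq_trans (leq_imset_card _ _) _; rewrite card_ord.
apply: leq_trans TC; apply/subset_leq_card/subsetP => v /SR vR.
have [hv|hv] := leqP (height v) e.
  case: (reach_below vR hv) => c' [m' [z' [o [o' [[<- <- oE <-] vE H]]]]].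
  case: o' vE H => [[i' d']|] vE H; last by rewrite vE !inE eqxx ?orbT.
  have [d2] := H _ _ erefl; rewrite -oE => -[ii _]; rewrite -{}ii in vE.
  rewrite vE !inE /T; case: ifP => de; last first.
    by rewrite !inE; do 2!(apply/orP; right); apply/imsetP; exists d'.
  case: vR => /[dup] /hrank_height; rewrite vE /= => dd'.
  have -> : d' = d by apply: val_inj => /=; have := ltn_ord d'; lia.
  by rewrite ltnn.
case: v hv vR => [[[x s]|[[c' m'] [[i' d']|]]] z'] /=; last by lia.
  move=> _ vR; have := @reach_var _ (x, z') s vR; rewrite /=.
  set bl := asg _ != s; case: ifP => [hi _|_].
    case: (hits_port hi) => [vE|[_ vE]]; rewrite /var /= in vE; rewrite vE !inE ?eqxx //.
    rewrite /T; case: ifP => _; first by apply/orP; right; apply/imsetP; exists i.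
    by rewrite !inE eqxx ?orbT.
  case: ifP => [/existsP[j hj]|_]; last by lia.
  rewrite (hubE hj) => sd; have := ltn_ord d; move=> de.
  have [s0 d1] : side s (lit c z j).2 = 0 /\ d.+1 = e by lia.
  have sE : (lit c z j).2 = s by apply/eqP; move: s0; rewrite /side; case: eqP.
  case/and3P: hj => _ /eqP lx _.
  rewrite !inE /T d1 eqxx; apply/orP; right; apply/imsetP; exists j => //.
  by rewrite /port lx sE.
by have := ltn_ord d'; lia.
Qed.

Lemma var_wreach_card x s (S : {set vert}) :
  (forall v, v \in S -> reach adj e.+2 hrank (var x s) v) -> #|S| <= k.
Proof.
move=> SR; apply: (@leq_trans 1) => //; rewrite -(cards1 (var x (~~ s))).
apply/subset_leq_card/subsetP => v /SR vR.
have [hv|hv] := leqP (height v) e.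
  by case: (reach_below vR hv) => c' [m' [z' [o [o' []]]]].
case: v hv vR => [[[x' s']|[[c' m'] [[i' d']|]]] z'] /=; last by lia.
  move=> _ vR; have := @reach_var _ (x', z') s' vR; rewrite /= -surjective_pairing.
  case: eqP => [xE _|_]; last by lia.
  rewrite inE; apply/eqP; rewrite /var xE /=; congr (inl (_, _), _).
  by case: vR; rewrite /var xE /=; case: (s) (s') => -[] //; rewrite ltnn.
by have := ltn_ord d'; lia.
Qed.

Lemma gadget_wcol_le : wcol e.+2 gadget_graph <= k.
Proof.
apply/wcol_leP; exists hrank; first exact: hrank_inj.
move=> [[[x s]|[[c m] [[i d]|]]] z] S.
- exact: (@var_wreach_card (x, z) s).
- exact: arm_wreach_card.
- exact: hub_wreach_card.
Qed.

End Upper.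

(** * From an ordering to an assignment *)

Section Lower.
Variable rk : vert -> nat.
Hypothesis rk_bound : forall (u : vert) (S : {set vert}),
  (forall v, v \in S -> reach adj e.+2 rk u v) -> #|S| <= k.

Definition order_asg (x : VK * Z) : bool := rk (var x false) < rk (var x true).

(* The path leading from [port c z i] to the hub [node c m z None], which is [arm c m z i e]. *)
Definition arm c m z (i : 'I_A) (n : nat) : vert := node c m z (omap (pair i) (insub n)).

Lemma arm_hub c m z i : arm c m z i e = node c m z None.
Proof. by rewrite /arm insubF //= ltnn. Qed.

Lemma arm_adj c m z i n : n < e -> adj (arm c m z i n) (arm c m z i n.+1).
Proof.
move=> ne; rewrite /adj /arm (insubT (fun n => n < e) ne) /=.
case: insubP => [j _ je|]; first by rewrite /= !eqxx je eqxx.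
by rewrite -leqNgt /= => en; rewrite !eqxx /= orbF; apply/eqP; lia.
Qed.

Lemma arm_path c m z i n : act c z -> n <= e ->
  path adj (port c z i) [seq arm c m z i j | j <- iota 0 n.+1].
Proof.
move=> ac ne; rewrite /=; apply/andP; split.
  by rewrite /arm (insubT (fun n => n < e) e_gt0) /adj /= ac -!surjective_pairing eqxx.
suff H b a : a + b <= e -> path adj (arm c m z i a) [seq arm c m z i j | j <- iota a.+1 b].
  exact: H.
elim: b a => //= b IH a ab; rewrite arm_adj; last by lia.
by apply: IH; lia.
Qed.

Lemma mate_adj c z i : adj (port c z i) (mate c z i).
Proof. by rewrite /adj /= !eqxx; case: (_.2). Qed.

Hypothesis rk_inj : injective rk.

Definition high c z i m := [exists n : 'I_e.+1, rk (port c z i) < rk (arm c m z i n)].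

(* The first vertex above the port on the arm of each high copy is reachable from the port. *)
Lemma high_card c z i : act c z -> #|[set m | high c z i m]| <= k.
Proof.
move=> ac.
have [g gP] : exists g : 'I_copies -> vert, forall m, high c z i m ->
    reach adj e.+2 rk (port c z i) (g m) /\ exists o, g m = node c m z o.
  apply: (@fin_all_exists 'I_copies (fun=> vert) (fun m v => high c z i m ->
    reach adj e.+2 rk (port c z i) v /\ exists o, v = node c m z o)) => m; case: (boolP (high c z i m)) => [/existsP[n0 hn0]|]; last first.
    by exists (port c z i).
  have ex : exists n, rk (port c z i) < rk (arm c m z i n) by exists n0.
  case: (ex_minnP ex) => n hn nmin; exists (arm c m z i n) => _; split; last by eexists.
  have ne : n <= e by apply: leq_trans (nmin _ hn0) _; rewrite -ltnS.
  split=> //; exists [seq arm c m z i j | j <- iota 0 n.+1]; split.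
  - exact: arm_path.
  - by rewrite -(addn1 n) iotaD map_cat last_cat.
  - by rewrite size_map size_iota ltnS; apply: leq_trans ne _.
  - rewrite -(addn1 n) iotaD map_cat /= cats1 belast_rcons /= hn /=.
    apply/allP => w /mapP[j]; rewrite mem_iota /= add0n => jn ->.
    apply: leq_ltn_trans hn; rewrite leqNgt; apply/negP => /nmin.
    by rewrite leqNgt jn.
rewrite -(card_in_imset (f := g)).
  by apply: (rk_bound (u := port c z i)) => v /imsetP[m]; rewrite inE => /gP[? _] ->.
move=> m m'; rewrite !inE => /gP[_ [o ->]] /gP[_ [o' ->]].
by case.
Qed.

(** Pigeonhole: by [high_card] at most [A * k] copies are high on some arm. *)
Lemma low_copy c z : act c z -> exists m, forall i n, n <= e ->
  rk (arm c m z i n) < rk (port c z i).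
Proof.
move=> ac; pose H := \bigcup_(i in 'I_A) [set m | high c z i m].
have HC : #|H| < #|'I_copies|.
  rewrite card_ord ltnS /H -[X in _ <= X * _]card_ord -sum_nat_const.
  elim/big_rec2: _ => [|i a B _ Ba]; first by rewrite cards0.
  by apply: leq_trans (leq_card_setU _ _) _; apply: leq_add => //; apply: high_card.
have /existsP[m mH] : [exists m, m \notin H].
  rewrite -negb_forall; apply: contraL HC => /forallP HH; rewrite -leqNgt.
  by apply/subset_leq_card/subsetP => m _.
exists m => i n ne; rewrite ltn_neqAle leqNgt; apply/andP; split.
  by apply/eqP => /rk_inj.
apply: contra mH => h; apply/bigcupP; exists i => //; rewrite inE; apply/existsP.
by exists (Ordinal (ne : n < e.+1)).
Qed.

(** In a low copy the hub reaches every port along its arm and, one step further, the mate of every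
    false literal, which lies above the port. All these ends are distinct, so [A] plus the number of
    false literals is at most [k = A + 2]. *)
Lemma order_asg_sat c z : act c z ->
  #|[set i | order_asg (lit c z i).1 != (lit c z i).2]| <= 2.
Proof.
move=> ac; have [m low] := low_copy ac.
pose F := [set i | order_asg (lit c z i).1 != (lit c z i).2].
have walkP i : exists p, [/\ path adj (node c m z None) (rcons p (port c z i)),
    size p = e & all (fun w => rk w < rk (port c z i)) (node c m z None :: p)].
  have := arm_path m i ac (leqnn e).
  rewrite -(eq_path (e := fun x y => adj y x)) => [|x y]; last exact: adj_sym.
  rewrite -rev_path -(addn1 e) iotaD map_cat /= add0n cats1 last_rcons belast_rcons arm_hub.
  rewrite rev_cons => pp; exists (rev [seq arm c m z i j | j <- iota 0 e]); split=> //.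
    by rewrite size_rev size_map size_iota.
  rewrite /= -(arm_hub c m z i) low //= all_rev; apply/allP => w /mapP[j].
  by rewrite mem_iota => /andP[_ je] ->; apply: low; apply: ltnW.
have portR i : reach adj e.+2 rk (node c m z None) (port c z i).
  have [p [pp sp ap]] := walkP i; split; first by case/andP: ap.
  exists (rcons p (port c z i)); split=> //; first by rewrite last_rcons.
    by rewrite size_rcons sp.
  by rewrite belast_rcons.
have mateR i : i \in F -> reach adj e.+2 rk (node c m z None) (mate c z i).
  rewrite inE /order_asg => Fi.
  have pm : rk (port c z i) < rk (mate c z i).
    rewrite ltn_neqAle; apply/andP; split.
      by apply/eqP => /rk_inj; rewrite /port /mate; case; case: (_.2).
    rewrite /port /mate; case: (lit c z i) Fi => x [] /=; case: ltnP => // + _ //; exact: ltnW.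
  have [p [pp sp ap]] := walkP i; split; first by apply: ltn_trans pm; case/andP: ap.
  exists (rcons (rcons p (port c z i)) (mate c z i)); split.
  - by rewrite rcons_path pp last_rcons mate_adj.
  - by rewrite last_rcons.
  - by rewrite !size_rcons sp.
  - rewrite belast_rcons -rcons_cons all_rcons pm /=.
    by apply: (@sub_all _ _ _ _ _ ap) => w /ltn_trans; apply.
pose S1 := [set port c z i | i in 'I_A]; pose S2 := [set mate c z i | i in F].
have : #|S1 :|: S2| <= k.
  apply: (rk_bound (u := node c m z None)) => v; rewrite inE => /orP[|] /imsetP[i iF ->] //.
  exact: mateR.
have varK x y s t : var x s = var y t -> x = y /\ s = t.
  by case: x y => [a b] [a' b'] [-> -> ->].
rewrite cardsU (_ : S1 :&: S2 = set0) ?cards0 ?subn0.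
  rewrite !card_in_imset; first by rewrite card_ord -/F; lia.
    by move=> i j _ _ /varK[/(lit_inj ac)].
  by move=> i j _ _ /varK[/(lit_inj ac)].
apply/setP => v; rewrite !inE; apply/negP => /andP[/imsetP[i _ ->] /imsetP[j _ /varK[/(lit_inj ac) ->]]].
by case: (_.2).
Qed.

End Lower.

Theorem gadget_wcolP : reflect
  (exists asg : VK * Z -> bool, forall c z, act c z ->
     #|[set i | asg (lit c z i).1 != (lit c z i).2]| <= 2)
  (wcol e.+2 gadget_graph <= k).
Proof.
apply: (iffP idP) => [/wcol_leP[rk rk_inj H]|[asg]]; last exact: gadget_wcol_le.
by exists (order_asg rk) => c z; apply: order_asg_sat.
Qed.
End Gadget.

(** * Turing machines on integer-indexed tapes *)

Notation sym := (option bool).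

Definition upd (T : Type) (tp : Z -> T) (h : Z) (b : T) : Z -> T :=
  fun z => if (z =? h)%Z then b else tp z.

Lemma upd_same T (tp : Z -> T) h : upd tp h (tp h) = tp.
Proof. by apply: functional_extensionality => z; rewrite /upd; case: Z.eqb_spec => [->|]. Qed.

Lemma updE T (tp : Z -> T) h b : upd tp h b h = b.
Proof. by rewrite /upd Z.eqb_refl. Qed.

Lemma updN T (tp : Z -> T) h b z : z <> h -> upd tp h b z = tp z.
Proof. by rewrite /upd; case: Z.eqb_spec. Qed.

Definition shift (m : move) : Z := match m with MoveL => -1 | MoveR => 1 | MoveS => 0 end.

Section Machine.
Variables (Q : Type) (halt : Q -> bool) (delta : Q -> sym -> Q * sym * move).

Definition gstep (c : Q * Z * (Z -> sym)) : Q * Z * (Z -> sym) :=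
  let: (q, h, tp) := c in
  if halt q then c else
  let: (q', b, m) := delta q (tp h) in (q', (h + shift m)%Z, upd tp h b).
End Machine.

(** Positions become absolute. Reading beyond the end of a list yields a blank, so lists that differ
    by trailing blanks represent the same tape. *)
Definition represents (M : TM) (c : config M) (a : 'I_(tm_nq M).+1 * Z * (Z -> sym)) : Prop :=
  let: (q, h, tp) := a in
  [/\ c_state c = q, c_cur c = tp h,
      forall i : nat, nth None (c_right c) i = tp (h + 1 + Z.of_nat i)%Z
    & forall i : nat, nth None (c_left c) i = tp (h - 1 - Z.of_nat i)%Z].

Lemma represents_step (M : TM) (c : config M) a :
  represents c a -> represents (step c) (gstep (@tm_halt M) (@tm_delta M) a).
Proof.
case: a c => [[q h] tp] [q0 l x rt] [/= -> -> Hr Hl].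
case: ifP => // _; case: (tm_delta q (tp h)) => [[q' b] m].
have E i j : i = j -> tp i = tp j by move=> ->.
case: m => /=.
- have tail i : nth None (b :: rt) i = upd tp h b (h + -1 + 1 + Z.of_nat i)%Z.
    case: i => [|i] /=; first by rewrite (_ : _ + _ = h)%Z ?updE //; lia.
    by rewrite updN ?Hr; [apply: E | ]; lia.
  case: l Hl => [|y l] Hl; split=> //=.
  + by rewrite updN; [have := Hl 0; rewrite /= => ->; apply: E | ]; lia.
  + by move=> i; rewrite nth_nil updN; [have := Hl i.+1; rewrite nth_nil => ->; apply: E|]; lia.
  + by rewrite updN; [have := Hl 0; rewrite /= => ->; apply: E | ]; lia.
  + by move=> i; rewrite updN; [have := Hl i.+1; rewrite /= => ->; apply: E|]; lia.
- have tail i : nth None (b :: l) i = upd tp h b (h + 1 - 1 - Z.of_nat i)%Z.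
    case: i => [|i] /=; first by rewrite (_ : _ - _ = h)%Z ?updE //; lia.
    by rewrite updN ?Hl; [apply: E | ]; lia.
  case: rt Hr => [|y rt] Hr; split=> //=.
  + by rewrite updN; [have := Hr 0; rewrite /= => ->; apply: E | ]; lia.
  + by move=> i; rewrite nth_nil updN; [have := Hr i.+1; rewrite nth_nil => ->; apply: E|]; lia.
  + by rewrite updN; [have := Hr 0; rewrite /= => ->; apply: E | ]; lia.
  + by move=> i; rewrite updN; [have := Hr i.+1; rewrite /= => ->; apply: E|]; lia.
- split=> //=.
  + by rewrite (_ : _ + _ = h)%Z ?updE //; lia.
  + by move=> i; rewrite updN ?Hr; [apply: E | ]; lia.
  + by move=> i; rewrite updN ?Hl; [apply: E | ]; lia.
Qed.

Lemma represents_run (M : TM) t (c : config M) a :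
  represents c a -> represents (run t c) (iter t (gstep (@tm_halt M) (@tm_delta M)) a).
Proof. by move=> ca; elim: t => //= t; apply: represents_step. Qed.

Definition tape_of (w : seq sym) (z : Z) : sym :=
  if (z <? 0)%Z then None else nth None w (Z.to_nat z).

Lemma represents_init (M : TM) w : represents (init_tape M w) (tm_start M, 0%Z, tape_of w).
Proof.
split=> [||i|i] //; rewrite /tape_of.
- case: Z.ltb_spec; first by lia.
  by move=> _; rewrite nth_behead; congr nth; lia.
- by rewrite nth_nil; case: Z.ltb_spec => //; lia.
Qed.

Lemma read_wordE (s : seq sym) (w : seq bool) :
  (forall i, nth None s i = nth None (map Some w) i) -> read_word s = w.
Proof.
elim: w s => [|b w IH] [|[a|] s] H //=.
- by have := H 0.
- by have := H 0.
- by have [->] := H 0; rewrite (IH s) // => i; apply: (H i.+1).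
- by have := H 0.
Qed.

(** * Machines over an arbitrary finite type of states *)

Section FinMachine.
Variables (Q : finType) (q0 : Q) (halt : Q -> bool) (delta : Q -> sym -> Q * sym * move).

Lemma card_states : #|Q| = #|Q|.-1.+1.
Proof. by rewrite prednK //; apply/card_gt0P; exists q0. Qed.

Definition to_ord (q : Q) : 'I_(#|Q|.-1.+1) := cast_ord card_states (enum_rank q).
Definition of_ord (i : 'I_(#|Q|.-1.+1)) : Q := enum_val (cast_ord (esym card_states) i).

Lemma to_ordK : cancel to_ord of_ord.
Proof. by move=> q; rewrite /of_ord cast_ordK enum_rankK. Qed.

Definition fin_tm : TM :=
  @mkTM #|Q|.-1 (to_ord q0) (fun i => halt (of_ord i)) (fun i => halt (of_ord i))
    (fun i a => let: (q, b, m) := delta (of_ord i) a in (to_ord q, b, m)).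

Lemma fin_tm_run t q h tp :
  iter t (gstep (@tm_halt fin_tm) (@tm_delta fin_tm)) (to_ord q, h, tp) =
  let: (q', h', tp') := iter t (gstep halt delta) (q, h, tp) in (to_ord q', h', tp').
Proof.
elim: t => //= t ->; case: (iter t _ _) => [[q' h'] tp'] /=.
by rewrite to_ordK; case: ifP => //; case: (delta _ _) => [[? ?] ?].
Qed.

Lemma fin_tm_computes (x w : seq bool) t q h tp :
  iter t (gstep halt delta) (q0, 0%Z, tape_of (map Some x)) = (q, h, tp) ->
  halt q -> (forall i, tp (h + Z.of_nat i)%Z = nth None (map Some w) i) ->
  let c := run t (init_tape fin_tm (map Some x)) in halted c /\ output c = w.
Proof.
move=> tE hq wE c.
have := represents_run t (represents_init fin_tm (map Some x)).
rewrite fin_tm_run {}tE /= -/c => -[cq cc cr _].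
split; first by rewrite /halted cq /= to_ordK.
apply: read_wordE => -[|i] /=; first by rewrite cc -wE /=; congr tp; lia.
by rewrite cr -(wE i.+1); congr tp; lia.
Qed.
End FinMachine.

(** * Stack machines *)

Definition disp (right : bool) (n : nat) : Z := if right then Z.of_nat n else (- Z.of_nat n)%Z.

Lemma iter1 T (f : T -> T) x : iter 1 f x = f x.
Proof. by []. Qed.

(** * Machines that jump several cells in one step *)

Section Macro.
Variables (Q : finType) (D : nat).
Variable delta : Q -> sym -> Q * sym * (bool * 'I_D.+1).

Definition mstep (c : Q * Z * (Z -> sym)) : Q * Z * (Z -> sym) :=
  let: (q, h, tp) := c in
  let: (q', b, (r, n)) := delta q (tp h) in (q', (h + disp r n)%Z, upd tp h b).

(** The second component is the displacement that remains to be walked; a step of the jumping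
    machine takes place when it is zero. *)
Definition mQ : finType := (Q * (bool * 'I_D.+1))%type.

Definition mdelta (s : mQ) (a : sym) : mQ * sym * move :=
  let: (q, (r, n)) := s in
  if n == 0 :> nat then let: (q', b, rn) := delta q a in ((q', rn), b, MoveS)
  else ((q, (r, inord n.-1)), a, if r then MoveR else MoveL).

Variable qh : Q.
Definition mhalt (s : mQ) : bool := (s.1 == qh) && (s.2.2 == 0 :> nat).

Lemma mdelta_walk q r (n : 'I_D.+1) h tp :
  iter n (gstep mhalt mdelta) ((q, (r, n)), h, tp) = ((q, (r, ord0)), (h + disp r n)%Z, tp).
Proof.
case: n => n nD /=; elim: n nD h => [|n IH] nD h /=.
  by rewrite (_ : (_ + _)%Z = h); [congr ((_, (_, _)), _, _); apply: val_inj|case: (r) => /=; lia].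
rewrite -iterS iterSr /= /mhalt /= andbF upd_same.
have nD' : n < D.+1 by lia.
rewrite (_ : inord n = Ordinal nD'); last by apply: val_inj; rewrite /= inordK.
by rewrite IH; congr (_, _, _); case: (r) => /=; lia.
Qed.

Lemma mdelta_step q r h tp : q != qh ->
  exists n r', n <= D.+1 /\ iter n (gstep mhalt mdelta) ((q, (r, ord0)), h, tp) =
    let: (q', h', tp') := mstep (q, h, tp) in ((q', (r', ord0)), h', tp').
Proof.
move=> qqh; rewrite /mstep; case E: (delta q (tp h)) => [[q' b] [r' n]].
exists n.+1, r'; split; first by rewrite ltn_ord.
by rewrite iterSr /= /mhalt /= (negPf qqh) /= E /= Z.add_0_r mdelta_walk.
Qed.

Lemma mdelta_run t q r h tp : (forall i, i < t -> (iter i mstep (q, h, tp)).1.1 != qh) ->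
  exists n r', n <= t * D.+1 /\ iter n (gstep mhalt mdelta) ((q, (r, ord0)), h, tp) =
    let: (q', h', tp') := iter t mstep (q, h, tp) in ((q', (r', ord0)), h', tp').
Proof.
elim: t => [|t IH] H; first by exists 0, r.
have [|n [r' [nt nE]]] := IH; first by move=> i it; apply: H; rewrite ltnS ltnW.
have := H t (leqnn _); rewrite /=; case: (iter t mstep _) nE => [[q' h'] tp'] nE qn.
have [n' [r'' [nt' nE']]] := mdelta_step r' h' tp' qn.
by exists (n' + n), r''; split; [rewrite mulSn leq_add | rewrite iterD nE nE'].
Qed.
End Macro.

(** * Stack machines and their simulation on one tape *)

Inductive instr := IPush of nat & bool | IPop of nat & nat & nat & nat | IJmp of nat.

Definition stacks := nat -> seq bool.
Definition sset (st : stacks) (j : nat) (s : seq bool) : stacks :=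
  fun i => if i == j then s else st i.

(** The default instruction makes the end of the code a fixed point of [fstep], so arriving there
    plays the role of halting. *)
Definition fetch (code : seq instr) pc := nth (IJmp (size code)) code pc.

Definition fstep (code : seq instr) (c : nat * stacks) : nat * stacks :=
  let: (pc, st) := c in
  match fetch code pc with
  | IPush j b => (pc.+1, sset st j (b :: st j))
  | IPop j a1 a0 an =>
      match st j with
      | [::] => (an, st)
      | b :: s => (if b then a1 else a0, sset st j s)
      end
  | IJmp a => (a, st)
  end.

Definition istack (i : instr) := match i with IPush j _ | IPop j _ _ _ => j | IJmp _ => 0 end.

Definition target (i : instr) (pc : nat) (o : sym) : nat :=
  match i with
  | IPush _ _ => pc.+1
  | IPop _ a1 a0 an => match o with Some b => if b then a1 else a0 | None => an end
  | IJmp a => a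
  end.

Section StackMachine.
Variables (code : seq instr) (K : nat).
Hypothesis code_wf : forall pc o, pc < size code ->
  istack (fetch code pc) < K /\ target (fetch code pc) pc o <= size code.

Notation n := (size code).

(* Stack 0 lies to the right of the home cell -1, bottom first; the other stacks are interleaved to its left.
   Cell 0 of each track is blank and serves as end marker. *)
Definition rightward (j : nat) := j == 0.
Definition stride (j : nat) := if j == 0 then 1 else K.
Definition pos (j p : nat) : Z := (-1 + disp (rightward j) (j + stride j * p))%Z.
Definition entry (s : seq bool) (p : nat) : sym := nth None (None :: map Some (rev s)) p.
Definition trep (tp : Z -> sym) (st : stacks) : Prop :=
  forall j p, j < K -> tp (pos j p) = entry (st j) p.

Definition phase : finType := option (bool + option bool).
Notation Start := (None : phase).
Notation Out := (Some (inl false) : phase).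
Notation Top := (Some (inl true) : phase).
Notation Ret o := (Some (inr o) : phase).

Definition SQ : finType := option ('I_n.+1 * phase).
Definition at_pc (pc : nat) (ph : phase) : SQ := Some (inord pc, ph).

(** The longest jump leads from the home cell over the end marker to the first entry of stack [j].
    Its length [j + stride j] determines the bound [2 * K]. *)
Definition sdelta_at (pc : nat) (ph : phase) (a : sym) : SQ * sym * (bool * 'I_(2 * K).+1) :=
  let i := fetch code pc in
  let j := istack i in
  let out := rightward j in
  match ph with
  | None =>
      match i with
      | IJmp t => (at_pc t Start, a, (true, ord0))
      | _ => (at_pc pc Out, a, (out, inord (j + stride j)))
      end
  | Some (inl false) =>
      if a is Some _ then (at_pc pc Out, a, (out, inord (stride j))) else
      match i with
      | IPush _ b => (at_pc pc (Ret None), Some b, (~~ out, inord (stride j)))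
      | _ => (at_pc pc Top, a, (~~ out, inord (stride j)))
      end
  | Some (inl true) =>
      if a is Some b then (at_pc pc (Ret (Some b)), None, (~~ out, inord (stride j)))
      else (at_pc (target i pc None) Start, a, (~~ out, inord j))
  | Some (inr o) =>
      if a is Some _ then (at_pc pc (Ret o), a, (~~ out, inord (stride j)))
      else (at_pc (target i pc o) Start, a, (~~ out, inord j))
  end.

(** At the end of the code the head moves one cell to the right of home, to the cell 0 where the
    output begins. *)
Definition sdelta (q : SQ) (a : sym) : SQ * sym * (bool * 'I_(2 * K).+1) :=
  if q is Some (pc, ph) then
    if pc == n :> nat then (None, a, (true, inord 1)) else sdelta_at pc ph a
  else (None, a, (true, ord0)).

Lemma stride_bound j : j < K -> stride j < (2 * K).+1.
Proof. by rewrite /stride; case: eqP; lia. Qed.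

Lemma pos_out j p : j < K ->
  (pos j p + disp (rightward j) (inord (stride j) : 'I_(2 * K).+1))%Z = pos j p.+1.
Proof.
move=> /stride_bound jK; rewrite inordK // /pos /disp mulnS.
by move: (stride j * p) => a; case: rightward; cbn [negb]; lia.
Qed.

Lemma pos_back j p : j < K ->
  (pos j p.+1 + disp (~~ rightward j) (inord (stride j) : 'I_(2 * K).+1))%Z = pos j p.
Proof.
move=> /stride_bound jK; rewrite inordK // /pos /disp mulnS.
by move: (stride j * p) => a; case: rightward; cbn [negb]; lia.
Qed.

Lemma pos_home j : j < K ->
  (pos j 0 + disp (~~ rightward j) (inord j : 'I_(2 * K).+1))%Z = (-1)%Z.
Proof. by move=> jK; rewrite inordK /pos /disp ?muln0; [case: rightward; cbn [negb]; lia | lia]. Qed.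

Lemma pos_start j : j < K ->
  (-1 + disp (rightward j) (inord (j + stride j) : 'I_(2 * K).+1))%Z = pos j 1.
Proof.
move=> jK; rewrite inordK; last by rewrite /stride; case: eqP; lia.
by rewrite /pos /disp muln1.
Qed.

Lemma pos_inj j p j' p' : j < K -> j' < K -> pos j p.+1 = pos j' p' -> j = j' /\ p.+1 = p'.
Proof.
move=> jK jK'; rewrite /pos /disp /rightward /stride.
case: eqP => j0; case: eqP => j0'; [by lia | by nia | by nia |] => E.
have {}E : p.+1 * K + j = p' * K + j' by lia.
have := congr1 (modn^~ K) E; rewrite !modnMDl !modn_small // => jj; split=> //.
by nia.
Qed.

Lemma trep_set tp st j p a s : trep tp st -> j < K ->
  (forall i, entry s i = if i == p.+1 then a else entry (st j) i) ->
  trep (upd tp (pos j p.+1) a) (sset st j s).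
Proof.
move=> R jK E j' p' jK'; rewrite /sset; case: (eqVneq j' j) => [->|jj].
  rewrite E; case: eqVneq => [->|pp]; first by rewrite updE.
  by rewrite updN ?R // => /esym /(pos_inj jK jK)[_ /esym /eqP]; rewrite (negPf pp).
by rewrite updN ?R // => /esym /(pos_inj jK jK')[/esym /eqP]; rewrite (negPf jj).
Qed.

Lemma entry_some s p : p < size s -> exists b, entry s p.+1 = Some b.
Proof.
move=> ps; exists (nth false (rev s) p).
by rewrite /entry /= (nth_map false) // size_rev.
Qed.

Lemma entry_none s p : size s <= p -> entry s p.+1 = None.
Proof. by move=> sp; rewrite /entry /= nth_default // size_map size_rev. Qed.

Lemma entry_push b s i : entry (b :: s) i = if i == (size s).+1 then Some b else entry s i.
Proof.
rewrite /entry; case: i => //= i; rewrite rev_cons map_rcons nth_rcons size_map size_rev eqSS.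
by case: ltngtP => // si; rewrite nth_default // size_map size_rev ltnW.
Qed.

Lemma entry_pop b s i : entry s i = if i == (size s).+1 then None else entry (b :: s) i.
Proof. by rewrite entry_push; case: eqP => // ->; apply: entry_none. Qed.

Notation ms := (mstep sdelta).

Section Step.
Variable pc : nat.
Hypothesis pcn : pc < n.
Let i := fetch code pc.
Let j := istack i.

Let jK : j < K. Proof. by case: (code_wf None pcn). Qed.

Lemma mstep_at ph h tp : ms (at_pc pc ph, h, tp) =
  let: (q', b, (r, m)) := sdelta_at pc ph (tp h) in (q', (h + disp r m)%Z, upd tp h b).
Proof. by rewrite /= inordK ?(ltn_eqF pcn) // ltnS ltnW. Qed.

Lemma out_walk st tp m p : trep tp st -> p + m = size (st j) ->
  iter m ms (at_pc pc Out, pos j p.+1, tp) = (at_pc pc Out, pos j (size (st j)).+1, tp).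
Proof.
move=> R; elim: m p => [|m IH] p; first by rewrite addn0 => ->.
move=> pm; rewrite iterSr mstep_at /sdelta_at -/i -/j.
have [b bE] : exists b, tp (pos j p.+1) = Some b by rewrite R //; apply: entry_some; lia.
by rewrite bE -bE upd_same pos_out // IH //; lia.
Qed.

Lemma ret_walk st tp o p : trep tp st -> p <= size (st j) ->
  iter p ms (at_pc pc (Ret o), pos j p, tp) = (at_pc pc (Ret o), pos j 0, tp).
Proof.
move=> R; elim: p => // p IH pm; rewrite iterSr mstep_at /sdelta_at -/i -/j.
have [b bE] : exists b, tp (pos j p.+1) = Some b by rewrite R //; apply: entry_some.
by rewrite bE -bE upd_same pos_back // IH // ltnW.
Qed.

Lemma ret_home st tp o : trep tp st ->
  ms (at_pc pc (Ret o), pos j 0, tp) = (at_pc (target i pc o) Start, (-1)%Z, tp).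
Proof.
move=> R; rewrite mstep_at /sdelta_at -/i -/j.
have bE : tp (pos j 0) = None by rewrite R.
by rewrite bE -bE upd_same pos_home.
Qed.

Lemma flat_step st tp : trep tp st -> exists t tp',
  [/\ t <= 2 * size (st j) + 3, trep tp' (fstep code (pc, st)).2 &
      iter t ms (at_pc pc Start, (-1)%Z, tp) =
        (at_pc (fstep code (pc, st)).1 Start, (-1)%Z, tp')].
Proof.
move=> R; rewrite [fstep _ _]/=.
have start : (if i is IJmp _ then False else True) ->
    iter (size (st j)).+1 ms (at_pc pc Start, (-1)%Z, tp) =
    (at_pc pc Out, pos j (size (st j)).+1, tp).
  move=> nj; rewrite iterSr mstep_at /sdelta_at -/i -/j.
  have -> : (match i with IJmp t => (at_pc t Start, tp (-1)%Z, (true, ord0))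
             | _ => (at_pc pc Out, tp (-1)%Z, (rightward j, inord (j + stride j))) end) =
     (at_pc pc Out, tp (-1)%Z, (rightward j, inord (j + stride j))) by case: i nj.
  by rewrite upd_same pos_start // (out_walk R).
have topE : tp (pos j (size (st j)).+1) = None by rewrite R // entry_none.
case iE: (fetch code pc) => [j' b|j' a1 a0 an|a]; last first.
- exists 1, tp; split=> //; first by rewrite !addn_gt0 orbT.
  by rewrite iter1 mstep_at /sdelta_at -/i /i iE upd_same Z.add_0_r.
- have jE : j' = j by rewrite /j /i iE.
  have {}start := start ltac:(by rewrite /i iE).
  have toTop : ms (at_pc pc Out, pos j (size (st j)).+1, tp) = (at_pc pc Top, pos j (size (st j)), tp).
    by rewrite mstep_at /sdelta_at -/i -/j topE -topE /i iE upd_same pos_back.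
  rewrite jE; case sE: (st j) => [|b s].
    exists (1 + (1 + (size (st j)).+1)), tp; split=> //; first by rewrite sE.
    rewrite !iterD !iter1 start toTop mstep_at sE /sdelta_at -/i -/j.
    have bE : tp (pos j 0) = None by rewrite R.
    have uE : upd tp (pos j 0) None = tp by rewrite -bE upd_same.
    by rewrite [size _]/= bE uE pos_home // /i iE.
  have R' : trep (upd tp (pos j (size s).+1) None) (sset st j s).
    by apply: trep_set => // p; rewrite sE; apply: entry_pop.
  exists (1 + (size s + (1 + (1 + (size (st j)).+1)))), (upd tp (pos j (size s).+1) None).
  split=> //; first by rewrite sE /=; lia.
  rewrite !iterD !iter1 start toTop mstep_at.
  rewrite /sdelta_at -/i -/j sE R // sE entry_push eqxx pos_back //.
  by rewrite (ret_walk _ R') ?/sset ?eqxx // (ret_home _ R') /i iE.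
- have jE : j' = j by rewrite /j /i iE.
  have {}start := start ltac:(by rewrite /i iE).
  have R' : trep (upd tp (pos j (size (st j)).+1) (Some b)) (sset st j (b :: st j)).
    by apply: trep_set => // p; apply: entry_push.
  exists (1 + (size (st j) + (1 + (size (st j)).+1))), (upd tp (pos j (size (st j)).+1) (Some b)).
  rewrite jE; split=> //; first by lia.
  rewrite !iterD !iter1 start mstep_at.
  rewrite /sdelta_at -/i -/j topE /i iE pos_back //.
  by rewrite (ret_walk _ R') ?/sset ?eqxx // (ret_home _ R') /i iE.
Qed.
End Step.

Lemma fstep_bound c B : (forall j, size (c.2 j) <= B) ->
  forall j, size ((fstep code c).2 j) <= B.+1.
Proof.
case: c => pc st /= H j; case: (fetch code pc) => [j' b|j' a1 a0 an|a] /=; last exact: leqW.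
  by rewrite /sset; case: eqP => _; rewrite /= ?ltnS ?H // leqW.
case E: (st j') => [|b s] /=; first exact: leqW.
by rewrite /sset; case: eqP => _; [have := H j'; rewrite E /=; lia | rewrite leqW].
Qed.

Lemma fstep_target c : c.1 <= n -> (fstep code c).1 <= n.
Proof.
case: c => pc st /=; rewrite leq_eqVlt => /orP[/eqP->|pcn].
  by rewrite /fetch nth_default.
case: (fetch code pc) (fun o => proj2 (code_wf o pcn)) => [j b|j a1 a0 an|a] H /=.
- exact: (H None).
- by case: (st j) => [|[] s] /=; [apply: (H None)|apply: (H (Some true))|apply: (H (Some false))].
- exact: (H None).
Qed.

Lemma flat_run T pc st tp B : pc <= n -> trep tp st -> (forall j, size (st j) <= B) ->
  let: (pc', st') := iter T (fstep code) (pc, st) in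
  [/\ pc' <= n, forall j, size (st' j) <= B + T &
    exists t tp', [/\ t <= T * (2 * (B + T) + 3), trep tp' st' &
      iter t ms (at_pc pc Start, (-1)%Z, tp) = (at_pc pc' Start, (-1)%Z, tp')]].
Proof.
move=> pcn R HB; elim: T => [|T].
  by rewrite /= addn0; split=> //; exists 0, tp.
rewrite iterS; case: (iter T _ _) => pc' st' [pcn' HB' [t [tp' [tT R' tE]]]].
have := @fstep_target (pc', st') pcn'; have := @fstep_bound (pc', st') _ HB'.
have [[pc2 st2] c2 [t2 [tp2 [tT2 R2 tE2]]]] : exists2 c2, c2 = fstep code (pc', st') &
    exists t tp2, [/\ t <= 2 * (B + T) + 3, trep tp2 c2.2 &
    iter t ms (at_pc pc' Start, (-1)%Z, tp') = (at_pc c2.1 Start, (-1)%Z, tp2)].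
  eexists; first by [].
  move: pcn'; rewrite leq_eqVlt => /orP[/eqP->|pcn'].
    by exists 0, tp'; rewrite /= /fetch nth_default.
  have [t2 [tp2 [tT2 R2 E2]]] := flat_step pcn' R'; exists t2, tp2; split=> //.
  by apply: leq_trans tT2 _; rewrite leq_add2r leq_mul2l HB'.
rewrite -{}c2 addnS => HB2 pcn2; split=> //; exists (t2 + t), tp2; split=> //.
  by nia.
by rewrite iterD tE tE2.
Qed.

Lemma halted_stays t c : c.1.1 = None :> SQ -> (iter t ms c).1.1 = None.
Proof. by case: c => [[q h] tp] /= ->; elim: t => //= t; case: (iter t _ _) => [[q' h'] tp'] /= ->. Qed.

(** The pending displacement first takes the head from cell 0 to the home cell -1. *)
Definition start_state : mQ SQ (2 * K) := (at_pc 0 Start, (false, inord 1)).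
Definition stack_tm : TM := fin_tm start_state (@mhalt _ _ None) (mdelta sdelta).
(** Stack 0 is written bottom first, so an input on the tape is a stack with its last bit on top. *)
Definition initial (x : seq bool) : stacks := fun j => if j == 0 then rev x else [::].

Lemma trep_initial x : trep (tape_of (map Some x)) (initial x).
Proof.
move=> j p jK; rewrite /pos /tape_of /initial /rightward /stride /entry.
case: eqP => [->|/eqP j0]; last first.
  case: Z.ltb_spec => [_|]; last by rewrite /disp; move: (K * p); lia.
  by case: p => //= p; rewrite nth_nil.
rewrite revK /disp mul1n; case: p => [|p] //; case: Z.ltb_spec => [|_]; first by lia.
by rewrite (_ : Z.to_nat _ = p) //; lia.
Qed.

Lemma stack_tm_computes x T st : 0 < K ->
  iter T (fstep code) (0, initial x) = (n, st) ->
  exists t, [/\ t <= 1 + (T * (2 * (size x + T) + 3)).+1 * (2 * K).+1,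
    halted (Defs.run t (init_tape stack_tm (map Some x))) &
    output (Defs.run t (init_tape stack_tm (map Some x))) = rev (st 0)].
Proof.
move=> K0 TE; have K1 : 1 < (2 * K).+1 by lia.
have HB j : size (initial x j) <= size x by rewrite /initial; case: eqP; rewrite ?size_rev.
have := @flat_run T 0 _ _ _ isT (trep_initial x) HB; rewrite TE.
case=> _ _ [t [tp [tT R tE]]].
have [|m [r [mt mE]]] := @mdelta_run _ _ sdelta None t.+1 (at_pc 0 Start) false (-1)%Z (tape_of (map Some x)).
  (* An earlier halt would persist up to time [t], when the machine is still at an address of the
     code. *)
  move=> i it; apply/eqP => hi.
  have := @halted_stays (t - i) _ hi.
  by rewrite -iterD subnK // tE.
have mE0 : iter (m + 1) (gstep (@mhalt _ _ None) (mdelta sdelta)) (start_state, 0%Z, tape_of (map Some x))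
    = ((None, (r, ord0)), 0%Z, upd tp (-1) (tp (-1)%Z)).
  rewrite iterD iter1 [gstep _ _ _]/= /mhalt /= !inordK //= upd_same.
  rewrite (_ : inord 0 = ord0); last by apply: val_inj; rewrite /= inordK.
  by rewrite mE iterS tE /= inordK // eqxx /disp /= inordK.
have [||hE oE] := @fin_tm_computes _ start_state (@mhalt _ _ None) (mdelta sdelta) x (rev (st 0)) _ _ _ _ mE0.
- by [].
- move=> i; rewrite upd_same; have := R 0 i.+1 K0.
  by rewrite /entry [X in _ = X -> _]/= => <-; congr tp; rewrite /pos /disp /rightward /stride eqxx mul1n; lia.
exists (m + 1); split=> //.
by rewrite addnC leq_add2l; apply: leq_trans mt _; rewrite leq_mul2r ltnS tT orbT.
Qed.
End StackMachine.

(** * Polynomial bounds *)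

Lemma leq_expl m n d : m <= n -> m ^ d <= n ^ d.
Proof. by case: d => [|d] // mn; rewrite leq_exp2r. Qed.

(** The base [n.+1] is positive, so exponents may be raised freely; this gives closure under sums,
    products and composition without an exception at 0. *)
Definition polyb (f : nat -> nat) : Prop := exists c d, forall n, f n <= c * n.+1 ^ d.

Lemma polyb_le f g : (forall n, f n <= g n) -> polyb g -> polyb f.
Proof. by move=> fg [c [d H]]; exists c, d => n; apply: leq_trans (fg n) (H n). Qed.

Lemma polyb_cst c : polyb (fun=> c).
Proof. by exists c, 0 => n; rewrite muln1. Qed.

Lemma polyb_id : polyb id.
Proof. by exists 1, 1 => n; rewrite mul1n expn1. Qed.

Lemma polybD f g : polyb f -> polyb g -> polyb (fun n => f n + g n).
Proof.
move=> [c [d H]] [c' [d' H']]; exists (c + c'), (maxn d d') => n; rewrite mulnDl.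
by apply: leq_add; [apply: leq_trans (H n) _|apply: leq_trans (H' n) _];
  rewrite leq_mul2l leq_pexp2l ?orbT // ?leq_maxl ?leq_maxr.
Qed.

Lemma polybM f g : polyb f -> polyb g -> polyb (fun n => f n * g n).
Proof.
move=> [c [d H]] [c' [d' H']]; exists (c * c'), (d + d') => n.
by rewrite expnD mulnACA leq_mul.
Qed.

Lemma polyb_comp f g : polyb f -> polyb g -> polyb (fun n => f (g n)).
Proof.
move=> [c [d H]] [c' [d' H']]; exists (c * (c'.+1) ^ d), (d' * d) => n.
apply: leq_trans (H _) _; rewrite -mulnA leq_mul2l expnM -expnMn; apply/orP; right.
apply: leq_expl; rewrite mulSn -add1n leq_add ?expn_gt0 ?H' //.
Qed.

Lemma polyb_bound f : polyb f -> exists c d, forall n, f n <= poly_bound c d n.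
Proof.
move=> [c [d H]]; exists (c * 2 ^ d), d => -[|n].
  apply: leq_trans (H 0) _; rewrite exp1n muln1 /poly_bound.
  by apply: leq_trans (leq_addl _ _); rewrite leq_pmulr // expn_gt0.
apply: leq_trans (H _) _; apply: leq_trans (leq_addr _ _).
by rewrite -mulnA leq_mul2l -expnMn leq_expl ?orbT //; lia.
Qed.

Theorem stack_machine_poly (f : seq bool -> seq bool) (code : seq instr) (K : nat) (T : nat -> nat) :
  0 < K -> (forall pc o, pc < size code ->
    istack (fetch code pc) < K /\ target (fetch code pc) pc o <= size code) ->
  polyb T ->
  (forall x, exists t st, [/\ t <= T (size x),
     iter t (fstep code) (0, initial x) = (size code, st) & rev (st 0) = f x]) ->
  poly_time_computable f.
Proof.
move=> K0 wf polyT H.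
have [c [d cd]] : exists c d, forall n,
    1 + (T n * (2 * (n + T n) + 3)).+1 * (2 * K).+1 <= poly_bound c d n.
  apply: polyb_bound; apply: polybD; first exact: polyb_cst.
  apply: polybM; last exact: polyb_cst.
  apply: (@polyb_le _ (fun n => 1 + T n * (2 * (n + T n) + 3))) => //.
  apply: polybD; first exact: polyb_cst.
  apply: polybM => //; apply: polybD; last exact: polyb_cst.
  by apply: polybM; [exact: polyb_cst | apply: polybD; [exact: polyb_id |]].
exists (stack_tm code K), c, d => x.
have [t [st [tT tE <-]]] := H x.
have [t' [tT' hE oE]] := stack_tm_computes wf K0 tE.
exists t'; split=> //; apply: leq_trans tT' _; apply: leq_trans (cd _).
by rewrite leq_add2l leq_mul2r ltnS; apply/orP; right; nia.
Qed.

(** * Structured stack programs *)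

Inductive cmd :=
  | CSkip
  | CPush of nat & bool
  | CSeq of cmd & cmd
  | CCase of nat & cmd & cmd & cmd
  | CLoop of nat & cmd & cmd.

(* Popping stack [j]: the branches are for [true], [false] and the empty stack; a loop ends on the empty stack. *)
Inductive exec : cmd -> stacks -> nat -> stacks -> Prop :=
  | ESkip st : exec CSkip st 0 st
  | EPush j b st : exec (CPush j b) st 1 (sset st j (b :: st j))
  | ESeq c1 c2 st1 st2 st3 t1 t2 : exec c1 st1 t1 st2 -> exec c2 st2 t2 st3 ->
      exec (CSeq c1 c2) st1 (t2 + t1) st3
  | ECase j ct cf cn st b s t st' : st j = b :: s ->
      exec (if b then ct else cf) (sset st j s) t st' -> exec (CCase j ct cf cn) st t.+2 st'
  | ECaseN j ct cf cn st t st' : st j = [::] -> exec cn st t st' ->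
      exec (CCase j ct cf cn) st t.+1 st'
  | ELoop j ct cf st b s t st' t' st'' : st j = b :: s ->
      exec (if b then ct else cf) (sset st j s) t st' -> exec (CLoop j ct cf) st' t' st'' ->
      exec (CLoop j ct cf) st (t' + t.+2) st''
  | ELoopN j ct cf st : st j = [::] -> exec (CLoop j ct cf) st 1 st.

Fixpoint csize (c : cmd) : nat :=
  match c with
  | CSkip => 0
  | CPush _ _ => 1
  | CSeq c1 c2 => csize c1 + csize c2
  | CCase _ ct cf cn => (csize ct + (csize cf + csize cn).+1).+2
  | CLoop _ ct cf => (csize ct + (csize cf).+1).+2
  end.

(** The argument [a] is the absolute address of the first instruction; all jump targets are computed
    from it and the sizes of the parts. *)
Fixpoint compile (c : cmd) (a : nat) : seq instr :=
  match c with
  | CSkip => [::]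
  | CPush j b => [:: IPush j b]
  | CSeq c1 c2 => compile c1 a ++ compile c2 (a + csize c1)
  | CCase j ct cf cn =>
      let at_ := a.+1 in let af := (at_ + csize ct).+1 in let an := (af + csize cf).+1 in
      IPop j at_ af an :: compile ct at_ ++ IJmp (an + csize cn) ::
        compile cf af ++ IJmp (an + csize cn) :: compile cn an
  | CLoop j ct cf =>
      let at_ := a.+1 in let af := (at_ + csize ct).+1 in
      IPop j at_ af (af + csize cf).+1 :: compile ct at_ ++ IJmp a :: compile cf af ++ [:: IJmp a]
  end.

Lemma size_comp c a : size (compile c a) = csize c.
Proof.
elim: c a => //= [c1 H1 c2 H2|j ct Ht cf Hf cn Hn|j ct Ht cf Hf] a.
- by rewrite size_cat H1 H2.
- by rewrite !(size_cat, Ht, Hf, Hn) /= size_cat Hf /= Hn; lia.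
- by rewrite !(size_cat, Ht, Hf) /= size_cat Hf /=; lia.
Qed.

Definition code_at (code : seq instr) (a : nat) (l : seq instr) : Prop :=
  exists pre post, code = pre ++ l ++ post /\ size pre = a.

Lemma code_at_cat code a l1 l2 : code_at code a (l1 ++ l2) ->
  code_at code a l1 /\ code_at code (a + size l1) l2.
Proof.
move=> [pre [post [-> <-]]]; split; first by exists pre, (l2 ++ post); rewrite -catA.
by exists (pre ++ l1), post; rewrite size_cat -!catA.
Qed.

Lemma code_at_cons code a i l : code_at code a (i :: l) ->
  fetch code a = i /\ code_at code a.+1 l.
Proof.
rewrite -cat1s => /code_at_cat[[pre [post [-> <-]]]]; rewrite addn1 => H; split=> //.
by rewrite /fetch nth_cat ltnn subnn.
Qed.

Lemma fstep_jmp code a b st : fetch code a = IJmp b -> fstep code (a, st) = (b, st).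
Proof. by rewrite /fstep => ->. Qed.

Lemma fstep_pop code a j a1 a0 an st b s : fetch code a = IPop j a1 a0 an -> st j = b :: s ->
  fstep code (a, st) = (if b then a1 else a0, sset st j s).
Proof. by rewrite /fstep => -> ->. Qed.

Lemma fstep_pop_nil code a j a1 a0 an st : fetch code a = IPop j a1 a0 an -> st j = [::] ->
  fstep code (a, st) = (an, st).
Proof. by rewrite /fstep => -> ->. Qed.

Lemma comp_correct c st t st' : exec c st t st' -> forall code a, code_at code a (compile c a) ->
  iter t (fstep code) (a, st) = (a + csize c, st').
Proof.
elim=> {c st t st'} [st|j b st|c1 c2 st1 st2 st3 t1 t2 _ H1 _ H2|j ct cf cn st b s t st' stE _ H|
   j ct cf cn st t st' stE _ H|j ct cf st b s t st' t' st'' stE _ H _ H'|j ct cf st stE] code a.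
- by rewrite addn0.
- by move=> /code_at_cons[fE _]; rewrite iter1 /= fE addn1.
- move=> /code_at_cat[/H1 E1]; rewrite size_comp => /H2 E2.
  by rewrite iterD E1 E2 /= addnA.
- rewrite [compile _ _]/= => /code_at_cons[fE] /code_at_cat[ca1 /code_at_cons[fE1 /code_at_cat[ca2 /code_at_cons[fE2 _]]]].
  rewrite !size_comp in ca2 fE1 fE2; rewrite iterSr (fstep_pop fE stE) iterS.
  by case: b {stE} H => ->; rewrite ?(fstep_jmp _ fE1) ?(fstep_jmp _ fE2) //=; congr pair; lia.
- rewrite [compile _ _]/= => /code_at_cons[fE] /code_at_cat[_ /code_at_cons[_ /code_at_cat[_ /code_at_cons[_]]]].
  rewrite !size_comp iterSr (fstep_pop_nil fE stE) => /H -> /=.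
  by congr pair; lia.
- move=> /[dup] ca; rewrite [compile _ _]/= => /code_at_cons[fE] /code_at_cat[ca1 /code_at_cons[fE1 /code_at_cat[ca2 /code_at_cons[fE2 _]]]].
  rewrite !size_comp in ca2 fE1 fE2; rewrite iterD iterSr (fstep_pop fE stE) iterS.
  case: b {stE} H => ->; rewrite ?(fstep_jmp _ fE1) ?(fstep_jmp _ fE2) //; exact: H'.
- rewrite [compile _ _]/= => /code_at_cons[fE _]; rewrite iter1 (fstep_pop_nil fE stE) /=.
  by congr pair; lia.
Qed.

Fixpoint targets_ok (hi a : nat) (l : seq instr) : bool :=
  if l is i :: l' then
    (if i is IPop _ a1 a0 an then [&& a1 <= hi, a0 <= hi & an <= hi] else target i a None <= hi)
    && targets_ok hi a.+1 l'
  else true.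

Lemma targets_ok_cat hi a l1 l2 :
  targets_ok hi a (l1 ++ l2) = targets_ok hi a l1 && targets_ok hi (a + size l1) l2.
Proof. by elim: l1 a => /= [|i l1 IH] a; rewrite ?addn0 // IH addSnnS andbA. Qed.

Lemma targets_ok_mono hi hi' a l : hi <= hi' -> targets_ok hi a l -> targets_ok hi' a l.
Proof.
move=> hh; elim: l a => //= i l IH a /andP[Hi /IH->]; rewrite andbT.
by case: i Hi => [j b|j a1 a0 an|a'] /=; lia.
Qed.

Lemma comp_targets_ok c a : targets_ok (a + csize c) a (compile c a).
Proof.
elim: c a => //= [j b|c1 H1 c2 H2|j ct Ht cf Hf cn Hn|j ct Ht cf Hf] a; first by rewrite addn1 ltnSn.
- rewrite targets_ok_cat size_comp; apply/andP; split.
    by apply: targets_ok_mono (H1 _); lia.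
  by apply: targets_ok_mono (H2 _); lia.
- do 2!rewrite targets_ok_cat /=; rewrite !size_comp.
  repeat (apply/andP; split); try lia.
  + by apply: targets_ok_mono (Ht _); lia.
  + by rewrite -addSn; apply: targets_ok_mono (Hf _); lia.
  + by rewrite -!addSn; apply: targets_ok_mono (Hn _); lia.
- do 2!rewrite targets_ok_cat /=; rewrite !size_comp.
  repeat (apply/andP; split); try lia.
  + by apply: targets_ok_mono (Ht _); lia.
  + by rewrite -addSn; apply: targets_ok_mono (Hf _); lia.
Qed.

Lemma targets_okP hi a l i o : targets_ok hi a l -> i < size l ->
  target (nth (IJmp 0) l i) (a + i) o <= hi.
Proof.
elim: l a i => // j l IH a [|i] /=; last by case/andP=> _ /IH H /H; rewrite addSnnS.
by rewrite addn0 => /andP[+ _] _ {IH}; case: j => //= _ a1 a0 an; case: o => [[]|]; lia.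
Qed.

Definition width (l : seq instr) : nat := foldr (fun i m => maxn (istack i).+1 m) 1 l.

Lemma widthP l i : i < size l -> istack (nth (IJmp 0) l i) < width l.
Proof. by elim: l i => // j l IH [|i] /=; rewrite leq_max ?leqnn // => /IH->; rewrite orbT. Qed.

Lemma width_gt0 l : 0 < width l.
Proof. by elim: l => //= i l IH; rewrite leq_max. Qed.

Theorem cmd_poly (f : seq bool -> seq bool) (c : cmd) (T : nat -> nat) : polyb T ->
  (forall x, exists t st, [/\ t <= T (size x), exec c (initial x) t st & rev (st 0) = f x]) ->
  poly_time_computable f.
Proof.
move=> polyT H; pose code := compile c 0.
apply: (@stack_machine_poly f code (width code) T) => //; first exact: width_gt0.
  move=> pc o pcn; rewrite /fetch (set_nth_default (IJmp 0)) //; split; first exact: widthP.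
  have := comp_targets_ok c 0; rewrite add0n -[csize c](size_comp c 0).
  by move/targets_okP => /(_ _ o pcn); rewrite add0n.
move=> x; have [t [st [tT tE oE]]] := H x; exists t, st; split=> //.
rewrite (comp_correct tE) ?size_comp //.
by exists [::], [::]; rewrite cats0.
Qed.

(** * Arithmetic loop programs *)

Definition runs c st B st' : Prop := exists2 t, t <= B & exec c st t st'.

Lemma runs_le c st B B' st' : B <= B' -> runs c st B st' -> runs c st B' st'.
Proof. by move=> BB [t tB H]; exists t => //; apply: leq_trans BB. Qed.

Lemma runs_skip st : runs CSkip st 0 st.
Proof. by exists 0 => //; constructor. Qed.

Lemma runs_push j b st : runs (CPush j b) st 1 (sset st j (b :: st j)).
Proof. by exists 1 => //; constructor. Qed.

Lemma runs_seq c1 c2 st B1 st1 B2 st2 :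
  runs c1 st B1 st1 -> runs c2 st1 B2 st2 -> runs (CSeq c1 c2) st (B1 + B2) st2.
Proof.
move=> [t1 tB1 H1] [t2 tB2 H2]; exists (t2 + t1); first by rewrite addnC leq_add.
exact: ESeq H1 H2.
Qed.

Lemma runs_case j ct cf cn st b s B st' : st j = b :: s ->
  runs (if b then ct else cf) (sset st j s) B st' -> runs (CCase j ct cf cn) st B.+2 st'.
Proof. by move=> E [t tB H]; exists t.+2 => //; apply: ECase E H. Qed.

Lemma runs_case_nil j ct cf cn st B st' : st j = [::] ->
  runs cn st B st' -> runs (CCase j ct cf cn) st B.+1 st'.
Proof. by move=> E [t tB H]; exists t.+1 => //; apply: ECaseN E H. Qed.

Lemma runs_loop j ct cf (w : seq bool) (s : nat -> stacks) B :
  (forall k, k <= size w -> s k j = drop k w) ->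
  (forall k, k < size w ->
     runs (if nth false w k then ct else cf) (sset (s k) j (drop k.+1 w)) B (s k.+1)) ->
  runs (CLoop j ct cf) (s 0) (size w * B.+2 + 1) (s (size w)).
Proof.
elim: w s => [|b w IH] s Hs H.
  by exists 1 => //; apply: ELoopN; rewrite Hs.
have [t tB tE] := H 0 isT; rewrite drop1 /= in tE.
have [k kw|k kw|t' tB' tE'] := IH (fun k => s k.+1).
- by rewrite Hs.
- exact: (H k.+1).
exists (t' + t.+2); first by rewrite /= mulSn; lia.
by apply: ELoop (tE) tE'; rewrite (Hs 0) ?drop0.
Qed.

Definition rset (rho : nat -> nat) (i v : nat) : nat -> nat := fun k => if k == i then v else rho k.

(* Stack 1 holds the input, stack 2 is auxiliary, and stack [i.+3] is the unary register [i]. *)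
Definition St (o a b : seq bool) (rho : nat -> nat) : stacks := fun j =>
  match j with 0 => o | 1 => a | 2 => b | i.+3 => nseq (rho i) true end.

Lemma sset0 o a b rho w : sset (St o a b rho) 0 w = St w a b rho.
Proof. by apply: functional_extensionality => -[|[|[|j]]]. Qed.
Lemma sset1 o a b rho w : sset (St o a b rho) 1 w = St o w b rho.
Proof. by apply: functional_extensionality => -[|[|[|j]]]. Qed.
Lemma sset2 o a b rho w : sset (St o a b rho) 2 w = St o a w rho.
Proof. by apply: functional_extensionality => -[|[|[|j]]]. Qed.
Lemma sset3 o a b rho i v : sset (St o a b rho) i.+3 (nseq v true) = St o a b (rset rho i v).
Proof.
by apply: functional_extensionality => -[|[|[|j]]] //; rewrite /sset /= /rset !eqSS; case: eqP.
Qed.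

Lemma rset_id rho i : rset rho i (rho i) = rho.
Proof. by apply: functional_extensionality => k; rewrite /rset; case: eqP => [->|]. Qed.

Ltac rext := apply: functional_extensionality; let k := fresh "k" in
  move=> k; rewrite /rset; repeat (case: eqP => ?); subst; try lia.

Lemma runs_inc o a b rho i :
  runs (CPush i.+3 true) (St o a b rho) 1 (St o a b (rset rho i (rho i).+1)).
Proof. by rewrite -sset3; apply: runs_push. Qed.

(* [rh k] and [os k] are the registers and the output after [k] rounds. *)
Lemma runs_rloop i c o a b (os : nat -> seq bool) (rh : nat -> nat -> nat) N B :
  os 0 = o -> (forall k, k <= N -> rh k i = N - k) ->
  (forall k, k < N -> runs c (St (os k) a b (rset (rh k) i (N - k.+1))) B (St (os k.+1) a b (rh k.+1))) ->
  runs (CLoop i.+3 c CSkip) (St o a b (rh 0)) (N * B.+2 + 1) (St (os N) a b (rh N)).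
Proof.
move=> <- Hi H; have := @runs_loop i.+3 c CSkip (nseq N true) (fun k => St (os k) a b (rh k)) B.
rewrite size_nseq; apply=> k kN; first by rewrite /= Hi // drop_nseq.
by rewrite nth_nseq kN drop_nseq sset3; apply: H.
Qed.

Lemma runs_clear i o a b rho :
  runs (CLoop i.+3 CSkip CSkip) (St o a b rho) (rho i * 2 + 1) (St o a b (rset rho i 0)).
Proof.
have := @runs_rloop i CSkip o a b (fun=> o) (fun k => rset rho i (rho i - k)) (rho i) 0.
rewrite subn0 rset_id subnn; apply=> // k; first by rewrite /rset eqxx.
move=> _; rewrite (_ : rset _ _ _ = rset rho i (rho i - k.+1)); first exact: runs_skip.
by rext.
Qed.

(** * Expressions over unary registers *)

Inductive expr :=
  | EVar of nat
  | ECst of nat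
  | EAdd of expr & expr
  | ESub of expr & expr
  | EMul of expr & expr
  | EBit of expr.

Fixpoint eval (x : seq bool) (rho : nat -> nat) (e : expr) : nat :=
  match e with
  | EVar i => rho i
  | ECst c => c
  | EAdd e1 e2 => eval x rho e1 + eval x rho e2
  | ESub e1 e2 => eval x rho e1 - eval x rho e2
  | EMul e1 e2 => eval x rho e1 * eval x rho e2
  | EBit e => nth false x (eval x rho e)
  end.

Fixpoint value_bound (e : expr) (m : nat) : nat :=
  match e with
  | EVar _ => m
  | ECst c => c
  | EAdd e1 e2 => value_bound e1 m + value_bound e2 m
  | ESub e1 e2 => value_bound e1 m
  | EMul e1 e2 => value_bound e1 m * value_bound e2 m
  | EBit _ => 1
  end.

Lemma eval_bound x rho e m : (forall i, rho i <= m) -> eval x rho e <= value_bound e m.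
Proof.
move=> H; elim: e => //= [e1 H1 e2 H2|e1 H1 e2 _|e1 H1 e2 H2|e _].
- exact: leq_add.
- exact: leq_trans (leq_subr _ _) H1.
- exact: leq_mul.
- by case: nth.
Qed.

(* The variables are the registers below [l]; the registers from [d >= l] on serve as temporaries. *)
Fixpoint cexpr (l : nat) (e : expr) (d : nat) : cmd :=
  match e with
  | EVar i =>
      if i < l then
        CSeq (CLoop i.+3 (CSeq (CPush d.+3 true) (CPush d.+4 true)) CSkip)
             (CLoop d.+4 (CPush i.+3 true) CSkip)
      else CSkip
  | ECst c => iter c (CSeq (CPush d.+3 true)) CSkip
  | EAdd e1 e2 => CSeq (cexpr l e1 d) (CSeq (cexpr l e2 d.+1) (CLoop d.+4 (CPush d.+3 true) CSkip))
  | ESub e1 e2 => CSeq (cexpr l e1 d) (CSeq (cexpr l e2 d.+1)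
      (CLoop d.+4 (CCase d.+3 CSkip CSkip CSkip) CSkip))
  | EMul e1 e2 => CSeq (cexpr l e1 d.+1) (CSeq (cexpr l e2 d.+2)
      (CSeq (CLoop d.+4 (CSeq (CLoop d.+2.+3 (CSeq (CPush d.+3 true) (CPush d.+3.+3 true)) CSkip)
                              (CLoop d.+3.+3 (CPush d.+2.+3 true) CSkip)) CSkip)
            (CLoop d.+2.+3 CSkip CSkip)))
  | EBit e => CSeq (cexpr l e d.+1)
      (CSeq (CLoop d.+4 (CCase 1 (CPush 2 true) (CPush 2 false) CSkip) CSkip)
      (CSeq (CCase 1 (CSeq (CPush 1 true) (CPush d.+3 true)) (CPush 1 false) CSkip)
            (CLoop 2 (CPush 1 true) (CPush 1 false))))
  end.

Fixpoint expr_time (e : expr) (m : nat) : nat :=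
  match e with
  | EVar i => m * 4 + 1 + (m * 3 + 1)
  | ECst c => c
  | EAdd e1 e2 => expr_time e1 m + (expr_time e2 m + (value_bound e2 m * 3 + 1))
  | ESub e1 e2 => expr_time e1 m + (expr_time e2 m + (value_bound e2 m * 4 + 1))
  | EMul e1 e2 => expr_time e1 m + (expr_time e2 m +
      (value_bound e1 m * (value_bound e2 m * 4 + 1 + (value_bound e2 m * 3 + 1) + 2) + 1
       + (value_bound e2 m * 2 + 1)))
  | EBit e => expr_time e m + ((value_bound e m * 5 + 1) + (4 + (m * 3 + 1)))
  end.

Lemma polyb_value e : polyb (value_bound e).
Proof.
elim: e => [i|c|e1 H1 e2 H2|e1 H1 e2 _|e1 H1 e2 H2|e _] /=.
- exact: polyb_id.
- exact: polyb_cst.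
- exact: polybD.
- exact: H1.
- exact: polybM.
- exact: polyb_cst.
Qed.

Ltac polyb_tac := repeat first [exact: polyb_id | exact: polyb_cst | exact: polyb_value
  | assumption | apply: polybD | apply: polybM].

Lemma polyb_expr_time e : polyb (expr_time e).
Proof. by elim: e => *; rewrite /expr_time -/expr_time; polyb_tac. Qed.

Lemma runs_move2 o a b rho i j1 j2 : i != j1 -> i != j2 -> j1 != j2 ->
  runs (CLoop i.+3 (CSeq (CPush j1.+3 true) (CPush j2.+3 true)) CSkip) (St o a b rho)
    (rho i * 4 + 1) (St o a b (rset (rset (rset rho i 0) j1 (rho j1 + rho i)) j2 (rho j2 + rho i))).
Proof.
move=> /eqP ij1 /eqP ij2 /eqP j12.
pose rh k := rset (rset (rset rho i (rho i - k)) j1 (rho j1 + k)) j2 (rho j2 + k).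
have E0 : rh 0 = rho by rewrite /rh; rext.
have -> : rset (rset (rset rho i 0) j1 (rho j1 + rho i)) j2 (rho j2 + rho i) = rh (rho i).
  by rewrite /rh subnn.
rewrite -[X in St _ _ _ X]E0.
apply: (runs_rloop (os := fun=> o)) => // k kN {E0}.
  by rewrite /rh /rset; repeat (case: eqP => ?); subst; lia.
apply: (@runs_le _ _ (1 + 1)) => //; apply: runs_seq; first exact: runs_inc.
have -> : rh k.+1 = rset (rset (rset (rh k) i (rho i - k.+1)) j1 (rset (rh k) i (rho i - k.+1) j1).+1) j2
   (rset (rset (rh k) i (rho i - k.+1)) j1 (rset (rh k) i (rho i - k.+1) j1).+1 j2).+1.
  by rewrite /rh; rext.
exact: runs_inc.
Qed.

Lemma runs_move o a b rho i j : i != j ->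
  runs (CLoop i.+3 (CPush j.+3 true) CSkip) (St o a b rho)
    (rho i * 3 + 1) (St o a b (rset (rset rho i 0) j (rho j + rho i))).
Proof.
move=> /eqP ij.
pose rh k := rset (rset rho i (rho i - k)) j (rho j + k).
have E0 : rh 0 = rho by rewrite /rh; rext.
have -> : rset (rset rho i 0) j (rho j + rho i) = rh (rho i) by rewrite /rh subnn.
rewrite -[X in St _ _ _ X]E0.
apply: (runs_rloop (os := fun=> o)) => // k kN {E0}.
  by rewrite /rh /rset; repeat (case: eqP => ?); subst; lia.
have -> : rh k.+1 = rset (rset (rh k) i (rho i - k.+1)) j (rset (rh k) i (rho i - k.+1) j).+1.
  by rewrite /rh; rext.
exact: runs_inc.
Qed.

Lemma runs_dec o a b rho i j : i != j ->
  runs (CLoop i.+3 (CCase j.+3 CSkip CSkip CSkip) CSkip) (St o a b rho)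
    (rho i * 4 + 1) (St o a b (rset (rset rho i 0) j (rho j - rho i))).
Proof.
move=> /eqP ij.
pose rh k := rset (rset rho i (rho i - k)) j (rho j - k).
have E0 : rh 0 = rho by rewrite /rh; rext.
have -> : rset (rset rho i 0) j (rho j - rho i) = rh (rho i) by rewrite /rh subnn.
rewrite -[X in St _ _ _ X]E0.
apply: (runs_rloop (os := fun=> o)) => // k kN {E0}.
  by rewrite /rh /rset; repeat (case: eqP => ?); subst; lia.
have jE : rset (rh k) i (rho i - k.+1) j = rho j - k.
  by rewrite /rh /rset eqxx; case: eqP => //; lia.
case E: (rho j - k) => [|n].
  rewrite (_ : rh k.+1 = rset (rh k) i (rho i - k.+1)); last by rewrite /rh; rext.
  by apply: (@runs_le _ _ 1) => //; apply: runs_case_nil (runs_skip _); rewrite /= jE E.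
apply: (@runs_case _ _ _ _ _ true (nseq n true)); first by rewrite /= jE E.
rewrite sset3 (_ : rh k.+1 = rset (rset (rh k) i (rho i - k.+1)) j n); first exact: runs_skip.
by rewrite /rh; rext.
Qed.

Lemma runs_addmul o a b rho i j t acc : uniq [:: i; j; t; acc] -> rho t = 0 ->
  runs (CLoop i.+3 (CSeq (CLoop j.+3 (CSeq (CPush acc.+3 true) (CPush t.+3 true)) CSkip)
                         (CLoop t.+3 (CPush j.+3 true) CSkip)) CSkip) (St o a b rho)
    (rho i * (rho j * 4 + 1 + (rho j * 3 + 1) + 2) + 1)
    (St o a b (rset (rset rho i 0) acc (rho acc + rho i * rho j))).
Proof.
rewrite /= !inE !negb_or andbT => /and3P[/and3P[/eqP ij /eqP it /eqP ia] /andP[/eqP jt /eqP ja] /eqP ta] t0.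
pose rh k := rset (rset rho i (rho i - k)) acc (rho acc + k * rho j).
have E0 : rh 0 = rho by rewrite /rh; rext.
have -> : rset (rset rho i 0) acc (rho acc + rho i * rho j) = rh (rho i) by rewrite /rh subnn.
rewrite -[X in St _ _ _ X]E0 !addn2.
apply: (runs_rloop (os := fun=> o)) => // k kN {E0}.
  by rewrite /rh /rset; repeat (case: eqP => ?); subst; lia.
set rho1 := rset (rh k) i _.
have j1 : rho1 j = rho j by rewrite /rho1 /rh /rset; repeat (case: eqP => ?); subst; lia.
have t1 : rho1 t = 0 by rewrite /rho1 /rh /rset; repeat (case: eqP => ?); subst; lia.
have a1 : rho1 acc = rho acc + k * rho j by rewrite /rho1 /rh /rset; repeat (case: eqP => ?); subst; lia.
have := @runs_move2 o a b rho1 j acc t ltac:(lia) ltac:(lia) ltac:(lia).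
set rho2 := rset _ t _; rewrite j1 => /runs_seq; apply.
have := @runs_move o a b rho2 t j ltac:(lia).
have -> : rho2 t = rho j by rewrite /rho2 /rset eqxx t1 j1.
congr (runs _ _ _ (St _ _ _ _)).
rewrite /rho2 j1 a1 t1; clear rho2 j1 t1 a1; rewrite /rho1 /rh; clear rho1 rh.
by apply: functional_extensionality => m; rewrite /rset mulSn; repeat (case: eqP => ?); subst; lia.
Qed.

Lemma runs_restore o a b rho :
  runs (CLoop 2 (CPush 1 true) (CPush 1 false)) (St o a b rho) (size b * 3 + 1)
    (St o (catrev b a) [::] rho).
Proof.
have := @runs_loop 2 (CPush 1 true) (CPush 1 false) b
  (fun k => St o (catrev (take k b) a) (drop k b) rho) 1.
rewrite take0 drop0 take_size drop_size; apply=> // k kb.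
have := runs_push 1 (nth false b k) (St o (catrev (take k b) a) (drop k.+1 b) rho).
rewrite sset2 sset1 (take_nth false kb) -cats1 /=.
have -> : catrev (take k b ++ [:: nth false b k]) a = nth false b k :: catrev (take k b) a.
  by rewrite !catrevE rev_cat.
by case: nth.
Qed.

Lemma runs_seek o x rho i :
  runs (CLoop i.+3 (CCase 1 (CPush 2 true) (CPush 2 false) CSkip) CSkip) (St o x [::] rho)
    (rho i * 5 + 1) (St o (drop (rho i) x) (rev (take (rho i) x)) (rset rho i 0)).
Proof.
have := @runs_loop i.+3 (CCase 1 (CPush 2 true) (CPush 2 false) CSkip) CSkip (nseq (rho i) true)
  (fun k => St o (drop k x) (rev (take k x)) (rset rho i (rho i - k))) 3.
rewrite size_nseq take0 drop0 subn0 rset_id subnn; apply=> k kN.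
  by rewrite /= /rset eqxx drop_nseq.
rewrite nth_nseq kN drop_nseq sset3.
have -> : rset (rset rho i (rho i - k)) i (rho i - k.+1) = rset rho i (rho i - k.+1) by rext.
have [kx|xk] := ltnP k (size x); last first.
  rewrite !(drop_oversize, take_oversize) ?(leqW xk) //.
  by apply: (@runs_le _ _ 1) => //; apply: runs_case_nil (runs_skip _).
apply: (@runs_case _ _ _ _ _ (nth false x k) (drop k.+1 x)); first by rewrite /= (drop_nth false kx).
rewrite sset1 (take_nth false kx) rev_rcons.
have := runs_push 2 (nth false x k) (St o (drop k.+1 x) (rev (take k x)) (rset rho i (rho i - k.+1))).
rewrite sset2 [St _ _ _ _ 2]/=; case: nth => H; exact: runs_le H.
Qed.

(** Values refer to [rho0], while the actual registers [rho] may already hold intermediate results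
    between [l] and [d]; the two agree below [l]. From [l] on [rho0] is zero, which is why a
    variable beyond [l] compiles to nothing. *)
Lemma cexpr_correct l x rho0 m : (forall i, rho0 i <= m) -> (forall i, l <= i -> rho0 i = 0) ->
  size x <= m ->
  forall e d rho o, l <= d -> (forall i, i < l -> rho i = rho0 i) -> (forall i, d <= i -> rho i = 0) ->
  runs (cexpr l e d) (St o x [::] rho) (expr_time e m) (St o x [::] (rset rho d (eval x rho0 e))).
Proof.
move=> bnd out xm.
pose spec e := forall d rho o, l <= d -> (forall i, i < l -> rho i = rho0 i) ->
  (forall i, d <= i -> rho i = 0) ->
  runs (cexpr l e d) (St o x [::] rho) (expr_time e m) (St o x [::] (rset rho d (eval x rho0 e))).
have two e1 e2 : spec e1 -> spec e2 -> forall d rho o, l <= d -> (forall i, i < l -> rho i = rho0 i) ->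
    (forall i, d <= i -> rho i = 0) ->
    runs (cexpr l e1 d) (St o x [::] rho) (expr_time e1 m) (St o x [::] (rset rho d (eval x rho0 e1))) /\
    runs (cexpr l e2 d.+1) (St o x [::] (rset rho d (eval x rho0 e1))) (expr_time e2 m)
      (St o x [::] (rset (rset rho d (eval x rho0 e1)) d.+1 (eval x rho0 e2))).
  move=> H1 H2 d rho o ld lr dr; split; first exact: H1.
  apply: H2; first exact: leqW.
    by move=> i il; rewrite /rset; case: eqP => ?; [lia | apply: lr].
  by move=> i il; rewrite /rset; case: eqP => ?; [lia | apply: dr; lia].
elim=> [i|c|e1 H1 e2 H2|e1 H1 e2 H2|e1 H1 e2 H2|e H] d rho o ld lr dr /=.
- case: ltnP => il; last first.
    by rewrite out // -(dr d) // rset_id; apply: runs_le (runs_skip _).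
  have rd := dr d (leqnn d); have rd1 := dr d.+1 (leqnSn d); have ri := lr i il; have Hi := bnd i.
  have H1 : runs _ _ _ _ := @runs_move2 o x [::] rho i d d.+1 _ _ _; have {H1} := H1 ltac:(lia) ltac:(lia) ltac:(lia).
  set rho1 := rset _ d.+1 _ => H1; have := @runs_move o x [::] rho1 d.+1 i ltac:(lia).
  have -> : rset (rset rho1 d.+1 0) i (rho1 i + rho1 d.+1) = rset rho d (rho0 i).
    by rewrite /rho1; clear H1 rho1; rext.
  have -> : rho1 d.+1 = rho i by rewrite /rho1 /rset eqxx rd1.
  move=> /(runs_seq H1); apply: runs_le; lia.
- have {dr lr} rd := dr d (leqnn d).
  suff G : forall k rho, runs (iter k (CSeq (CPush d.+3 true)) CSkip) (St o x [::] rho) k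
      (St o x [::] (rset rho d (rho d + k))) by have := G c rho; rewrite rd.
  elim=> [|k IH] rho1; first by rewrite addn0 rset_id; apply: runs_skip.
  have := runs_seq (runs_inc o x [::] rho1 d) (IH _); rewrite add1n.
  by congr (runs _ _ _ (St _ _ _ _)); rext.
- have {H1 H2} [H1 H2] := two _ _ H1 H2 d rho o ld lr dr.
  apply: runs_seq (H1) _; apply: runs_seq (H2) _.
  have Hv := eval_bound x e2 bnd.
  have := @runs_move o x [::] (rset (rset rho d (eval x rho0 e1)) d.+1 (eval x rho0 e2)) d.+1 d ltac:(lia).
  have -> : forall v, rset (rset rho d v) d.+1 (eval x rho0 e2) d = v.
    by move=> v; rewrite /rset eqxx; case: eqP => //; lia.
  rewrite [rset _ d.+1 _ d.+1]/rset eqxx => H.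
  apply: runs_le (_ : _ <= _) _; last first.
    move: H; congr (runs _ _ _ (St _ _ _ _)).
    by have rd1 := dr d.+1 (leqnSn d); clear -rd1; rext.
  by lia.
- have {H1 H2} [H1 H2] := two _ _ H1 H2 d rho o ld lr dr.
  apply: runs_seq (H1) _; apply: runs_seq (H2) _.
  have Hv := eval_bound x e2 bnd.
  have := @runs_dec o x [::] (rset (rset rho d (eval x rho0 e1)) d.+1 (eval x rho0 e2)) d.+1 d ltac:(lia).
  have -> : forall v, rset (rset rho d v) d.+1 (eval x rho0 e2) d = v.
    by move=> v; rewrite /rset eqxx; case: eqP => //; lia.
  rewrite [rset _ d.+1 _ d.+1]/rset eqxx => H.
  apply: runs_le (_ : _ <= _) _; last first.
    move: H; congr (runs _ _ _ (St _ _ _ _)).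
    by have rd1 := dr d.+1 (leqnSn d); clear -rd1; rext.
  by lia.
- have [|||{}H1 {}H2] := two _ _ H1 H2 d.+1 rho o.
  + exact: leqW.
  + exact: lr.
  + by move=> i il; apply: dr; lia.
  apply: runs_seq (H1) _; apply: runs_seq (H2) _.
  have Hv1 := eval_bound x e1 bnd; have Hv2 := eval_bound x e2 bnd.
  move: (eval x rho0 e1) (eval x rho0 e2) H1 H2 Hv1 Hv2 => v1 v2 _ _ Hv1 Hv2.
  set rho1 := rset _ d.+2 _.
  have rd := dr d (leqnn d); have rd1 := dr d.+1 (leqnSn d).
  have rd2 := dr d.+2 ltac:(lia); have rd3 := dr d.+3 ltac:(lia).
  have r1 : rho1 d.+1 = v1 by rewrite /rho1; clear; rewrite /rset; repeat (case: eqP => ?); lia.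
  have r2 : rho1 d.+2 = v2 by rewrite /rho1; clear; rewrite /rset; repeat (case: eqP => ?); lia.
  have r3 : rho1 d.+3 = 0 by rewrite /rho1; clear -rd3; rewrite /rset; repeat (case: eqP => ?); lia.
  have r0 : rho1 d = 0 by rewrite /rho1; clear -rd; rewrite /rset; repeat (case: eqP => ?); lia.
  have := @runs_addmul o x [::] rho1 d.+1 d.+2 d.+3 d _ r3.
  rewrite r1 r2 r0 add0n => /(_ ltac:(rewrite /= !inE; lia)) H.
  have := @runs_clear d.+2 o x [::] (rset (rset rho1 d.+1 0) d (v1 * v2)).
  have -> : rset (rset rho1 d.+1 0) d (v1 * v2) d.+2 = v2.
    by rewrite -r2; clear; rewrite /rset; repeat (case: eqP => ?); lia.
  move=> /(runs_seq H) {}H.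
  apply: runs_le (_ : _ <= _) _; last first.
    move: H; congr (runs _ _ _ (St _ _ _ _)).
    by rewrite /rho1; clear -rd1 rd2; rext.
  rewrite !leq_add // ?leq_mul // !leq_add // leq_mul //.
- have {}H := H d.+1 rho o (leqW ld) lr (fun i di => dr i (ltnW di)).
  apply: runs_seq (H) _.
  have Hv := eval_bound x e bnd; move: (eval x rho0 e) H Hv => v _ Hv.
  have rd := dr d (leqnn d); have rd1 := dr d.+1 (leqnSn d).
  have := @runs_seek o x (rset rho d.+1 v) d.+1.
  have -> : rset (rset rho d.+1 v) d.+1 0 = rho by clear -rd1; rext.
  rewrite [rset _ _ _ _]/rset eqxx => Hs.
  have rs0 : rset rho d false = rho by rewrite -[X in _ = X](rset_id rho d) rd.
  have Hc : runs (CCase 1 (CSeq (CPush 1 true) (CPush d.+3 true)) (CPush 1 false) CSkip)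
      (St o (drop v x) (rev (take v x)) rho) 4
      (St o (drop v x) (rev (take v x)) (rset rho d (nth false x v))).
    (* Beyond the end of the input stack 1 is empty and the register stays 0, in accordance with the
       default of [nth]. *)
    have [vx|xv] := ltnP v (size x); last first.
      rewrite drop_oversize // nth_default // rs0.
      by apply: (@runs_le _ _ 1) => //; apply: runs_case_nil (runs_skip _).
    apply: (@runs_case _ _ _ _ _ (nth false x v) (drop v.+1 x)); first by rewrite /= (drop_nth false vx).
    rewrite sset1 (drop_nth false vx).
    have := runs_push 1 (nth false x v) (St o (drop v.+1 x) (rev (take v x)) rho).
    rewrite sset1 [St _ _ _ _ 1]/=; case: nth => Hp.
      by have := runs_seq Hp (runs_inc _ _ _ _ d); rewrite rd.
    by rewrite rs0; apply: runs_le Hp.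
  have := runs_restore o (drop v x) (rev (take v x)) (rset rho d (nth false x v)).
  rewrite catrevE revK cat_take_drop => /(runs_seq Hc) /(runs_seq Hs); apply: runs_le.
  have : size (rev (take v x)) <= m by rewrite size_rev size_take_min geq_min xm orbT.
  by lia.
Qed.

(** * Loop programs that print bits *)

Inductive prog :=
  | PSkip
  | POut of expr
  | PSeq of prog & prog
  | PFor of expr & prog.

(* A loop entered at depth [d] keeps the number of remaining rounds in variable [d] and its counter in [d.+1]. *)
Definition loop_env (rho : nat -> nat) (d N v : nat) := rset (rset rho d (N - v.+1)) d.+1 v.

Fixpoint sem (x : seq bool) (rho : nat -> nat) (d : nat) (p : prog) : seq bool :=
  match p with
  | PSkip => [::]
  | POut e => [:: eval x rho e != 0]
  | PSeq p1 p2 => sem x rho d p1 ++ sem x rho d p2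
  | PFor e p => let N := eval x rho e in
      flatten [seq sem x (loop_env rho d N v) d.+2 p | v <- iota 0 N]
  end.

Fixpoint cprog (p : prog) (d : nat) : cmd :=
  match p with
  | PSkip => CSkip
  | POut e => CSeq (cexpr d e d)
      (CCase d.+3 (CSeq (CLoop d.+3 CSkip CSkip) (CPush 0 true)) CSkip (CPush 0 false))
  | PSeq p1 p2 => CSeq (cprog p1 d) (cprog p2 d)
  | PFor e p => CSeq (cexpr d e d)
      (CSeq (CLoop d.+3 (CSeq (cprog p d.+2) (CPush d.+4 true)) CSkip) (CLoop d.+4 CSkip CSkip))
  end.

Fixpoint prog_time (p : prog) (m : nat) : nat :=
  match p with
  | PSkip => 0
  | POut e => expr_time e m + (value_bound e m * 2 + 1 + 1 + 2)
  | PSeq p1 p2 => prog_time p1 m + prog_time p2 m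
  | PFor e p => expr_time e m + (value_bound e m * (prog_time p (m + value_bound e m) + 1 + 2) + 1
      + (value_bound e m * 2 + 1))
  end.

Lemma polyb_prog_time p : polyb (prog_time p).
Proof.
elim: p => [|e|p1 H1 p2 H2|e p H]; rewrite /prog_time -/prog_time; try by polyb_tac.
- by have := polyb_expr_time e => ?; polyb_tac.
- have := polyb_expr_time e => He.
  have : polyb (fun m => prog_time p (m + value_bound e m)).
    by apply: (@polyb_comp _ (fun m => m + value_bound e m)) => //; polyb_tac.
  by move=> Hp; polyb_tac.
Qed.

(** The output is pushed on stack 0 and therefore accumulates in reverse; loop bodies run with
    registers bounded by [m] plus the number of rounds. *)
Lemma cprog_correct x p : forall m d rho o, (forall i, rho i <= m) -> size x <= m ->
  (forall i, d <= i -> rho i = 0) ->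
  runs (cprog p d) (St o x [::] rho) (prog_time p m) (St (catrev (sem x rho d p) o) x [::] rho).
Proof.
elim: p => [|e|p1 H1 p2 H2|e p H] m d rho o bnd xm dr.
- exact: runs_skip.
- have He := cexpr_correct bnd dr xm e o (leqnn d) (fun i _ => erefl) dr.
  apply: runs_seq (He) _; have Hv := eval_bound x e bnd; rewrite [sem _ _ _ _]/=.
  case: (eval x rho e) He Hv => [|v] _ Hv.
    rewrite (_ : rset rho d 0 = rho); last by rewrite -[RHS](rset_id rho d) dr.
    apply: (@runs_le _ _ 2); first by lia.
    apply: runs_case_nil; first by rewrite /= dr.
    by have := runs_push 0 false (St o x [::] rho); rewrite sset0.
  apply: runs_le (_ : (v.+1 * 2 + 1 + 1).+2 <= _) _; first by lia.
  apply: (@runs_case _ _ _ _ _ true (nseq v true)); first by rewrite /= /rset eqxx.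
  rewrite sset3 (_ : rset _ _ _ = rset rho d v); last by rext.
  have := runs_clear d o x [::] (rset rho d v).
  rewrite (_ : rset _ d 0 = rho); last by move: (dr d (leqnn d)); clear => ?; rext.
  rewrite [rset rho d v d]/rset eqxx => Hc.
  have := runs_push 0 true (St o x [::] rho); rewrite sset0 => /(runs_seq Hc).
  by apply: runs_le; lia.
- rewrite [sem _ _ _ _]/= catrevE rev_cat -catA -!catrevE.
  exact: runs_seq (H1 _ _ _ _ bnd xm dr) (H2 _ _ _ _ bnd xm dr).
- have He := cexpr_correct bnd dr xm e o (leqnn d) (fun i _ => erefl) dr.
  rewrite [sem _ _ _ _]/=; have Hv := eval_bound x e bnd.
  move: (eval x rho e) He Hv => N He Hv.
  pose rh k := rset (rset rho d (N - k)) d.+1 k.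
  pose os k := catrev (flatten [seq sem x (loop_env rho d N v) d.+2 p | v <- iota 0 k]) o.
  have E0 : rh 0 = rset rho d N by rewrite /rh subn0; have := dr d.+1 (leqnSn d); clear; move=> ?; rext.
  have Hl : runs (CLoop d.+3 (CSeq (cprog p d.+2) (CPush d.+4 true)) CSkip) (St o x [::] (rh 0))
      (N * (prog_time p (m + value_bound e m) + 1).+2 + 1) (St (os N) x [::] (rh N)).
    apply: (runs_rloop (os := os)) => // k kN.
      by rewrite /rh; clear; rewrite /rset; repeat (case: eqP => ?); lia.
    have rE : rset (rh k) d (N - k.+1) = loop_env rho d N k by rewrite /rh /loop_env; clear; rext.
    have b' i : loop_env rho d N k i <= m + value_bound e m.
      have := bnd i; rewrite /loop_env; clear -kN Hv; rewrite /rset.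
      by repeat (case: eqP => ?); lia.
    have d' i : d.+2 <= i -> loop_env rho d N k i = 0.
      move=> di; have := dr i; rewrite /loop_env; clear -di; rewrite /rset.
      by repeat (case: eqP => ?); try lia; apply; lia.
    rewrite rE; have {}H := H _ d.+2 _ (os k) b' (leq_trans xm (leq_addr _ _)) d'.
    apply: runs_seq H _.
    have -> : rh k.+1 = rset (loop_env rho d N k) d.+1 (loop_env rho d N k d.+1).+1.
      by rewrite /rh /loop_env; clear; rext.
    have -> : os k.+1 = catrev (sem x (loop_env rho d N k) d.+2 p) (os k).
      rewrite /os -[k.+1]addn1 iotaD map_cat flatten_cat /= cats0 !catrevE rev_cat catA //.
    exact: runs_inc.
  have Hc := runs_clear d.+1 (os N) x [::] (rh N).
  have EN : rset (rh N) d.+1 0 = rho.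
    rewrite /rh subnn; move: (dr d (leqnn d)) (dr d.+1 (leqnSn d)); clear => ? ?; rext.
  have E1 : rh N d.+1 = N by rewrite /rh /rset eqxx.
  rewrite EN E1 in Hc; rewrite E0 in Hl.
  apply: runs_le (runs_seq He (runs_seq Hl Hc)).
  rewrite [prog_time (PFor e p) m]/= leq_add2l; apply: leq_add; last by lia.
  rewrite leq_add2r; apply: leq_mul => //; rewrite ?addn2 //.
Qed.

Theorem prog_poly (f : seq bool -> seq bool) (p : prog) :
  (forall x, f x = sem x (rset (fun=> 0) 0 (size x)) 1 p) -> poly_time_computable f.
Proof.
(* Moving the input from stack 0 to stack 1 puts its first bit on top, and the moved bits are
   counted in register 0, which is stack 3. *)
move=> fE; pose load := CLoop 0 (CSeq (CPush 1 true) (CPush 3 true)) (CSeq (CPush 1 false) (CPush 3 true)).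
apply: (@cmd_poly f (CSeq load (cprog p 1)) (fun n => n * 4 + 1 + prog_time p n)).
  by have := polyb_prog_time p => ?; polyb_tac.
move=> x.
have Hl : runs load (initial x) (size x * 4 + 1) (St [::] x [::] (rset (fun=> 0) 0 (size x))).
  have := @runs_loop 0 (CSeq (CPush 1 true) (CPush 3 true)) (CSeq (CPush 1 false) (CPush 3 true))
    (rev x) (fun k => St (drop k (rev x)) (rev (take k (rev x))) [::] (rset (fun=> 0) 0 k)) 2.
  rewrite drop0 take0 drop_size take_size revK size_rev.
  have -> : St (rev x) (rev [::]) [::] (rset (fun=> 0) 0 0) = initial x.
    by apply: functional_extensionality => -[|[|[|j]]] //; rewrite /= /rset; case: eqP.
  apply=> // k kx.
  have kx' : k < size (rev x) by rewrite size_rev.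
  rewrite sset0 (take_nth false kx') rev_rcons.
  have -> : rset (fun=> 0) 0 k.+1 = rset (rset (fun=> 0) 0 k) 0 (rset (fun=> 0) 0 k 0).+1 by rext.
  have := runs_push 1 (nth false (rev x) k) (St (drop k.+1 (rev x)) (rev (take k (rev x))) [::] (rset (fun=> 0) 0 k)).
  rewrite sset1 [St _ _ _ _ 1]/=; case: nth => Hp; exact: runs_seq Hp (runs_inc _ _ _ _ _).
have bnd i : rset (fun=> 0) 0 (size x) i <= size x by rewrite /rset; case: eqP.
have out i : 1 <= i -> rset (fun=> 0) 0 (size x) i = 0 by rewrite /rset; case: eqP => // ->.
have Hp := cprog_correct p [::] bnd (leqnn _) out.
have [t tT tE] := runs_seq Hl Hp.
by exists t; eexists; split; [exact: tT | exact: tE | rewrite /= catrevE cats0 revK -fE].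
Qed.

(** * The computation tableau *)

Section Tableau.
Variable M : TM.

Notation state := 'I_(tm_nq M).+1.
Definition cell : finType := (option bool * option state)%type.
Notation ustep := (gstep (@tm_halt M) (@tm_delta M)).

Definition cell_at (a : state * Z * (Z -> sym)) (z : Z) : cell :=
  let: (q, h, tp) := a in (tp z, if (z =? h)%Z then Some q else None).

Definition enters (mv : move) (c : cell) : option state :=
  if c is (a, Some q) then
    if tm_halt q then None else
    let: (q', _, mv') := tm_delta q a in
    match mv, mv' with MoveL, MoveL | MoveR, MoveR | MoveS, MoveS => Some q' | _, _ => None end
  else None.

(** A head arrives from the left neighbour by a right move or from the right neighbour by a left
    move. A halted head stays where it is, so the rows after halting are all equal. *)
Definition next_cell (l c r : cell) : cell :=
  if c is (a, Some q) then
    if tm_halt q then c else let: (_, b, _) := tm_delta q a in (b, enters MoveS c)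
  else (c.1, if enters MoveR l is Some q then Some q else enters MoveL r).

Lemma next_cellE a z : cell_at (ustep a) z =
  next_cell (cell_at a (z - 1)) (cell_at a z) (cell_at a (z + 1)).
Proof.
case: a => [[q h] tp]; rewrite /next_cell /=.
have [->|zh] := Z.eqb_spec z h.
  case hq: (tm_halt q); rewrite /= ?Z.eqb_refl ?hq //.
  case: (tm_delta q (tp h)) => [[q' b] mv] /=; rewrite updE.
  by case: mv => /=; case: Z.eqb_spec => //; lia.
case hq: (tm_halt q) => /=.
  have -> : (z =? h)%Z = false by case: Z.eqb_spec.
  by rewrite /enters /=; case: Z.eqb_spec => _ /=; case: Z.eqb_spec => _; rewrite ?hq.
case E: (tm_delta q (tp h)) => [[q' b] mv] /=; rewrite updN //.
case: (Z.eqb_spec (z - 1) h) => [hl|hl] /=.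
  rewrite hl hq E; case: (Z.eqb_spec (z + 1) h) => [|hr]; first by lia.
  by case: mv E => E /=; case: Z.eqb_spec => //; lia.
case: (Z.eqb_spec (z + 1) h) => [hr|hr] /=.
  rewrite hr hq E.
  by case: mv E => E /=; case: Z.eqb_spec => //; lia.
by case: mv E => E /=; case: Z.eqb_spec => //; lia.
Qed.

Lemma head_bound t a : let h := (iter t ustep a).1.2 in
  (a.1.2 - Z.of_nat t <= h <= a.1.2 + Z.of_nat t)%Z.
Proof.
elim: t => [|t] /=; first by lia.
case: (iter t _ _) => [[q h] tp] /=; case: ifP => _ /=; first by lia.
by case: (tm_delta q (tp h)) => [[q' b] []] /=; lia.
Qed.

Lemma run_halted t k (c : config M) : halted (run t c) -> run (t + k) c = run t c.
Proof.
move=> ht; rewrite addnC /run iterD -/(run t c); elim: k => //= k ->.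
by case: (run t c) ht => q l a rt; rewrite /halted /= => ->.
Qed.

Lemma run_halted_eq t t' (c : config M) : halted (run t c) -> halted (run t' c) -> run t c = run t' c.
Proof.
move=> ht ht'; case: (leqP t t') => [tt|/ltnW tt].
  by rewrite -(subnKC tt) run_halted.
by rewrite -(subnKC tt) run_halted.
Qed.
End Tableau.

(** * The tableau formula *)

Section Formula.
Variables (M : TM) (e : nat).
Hypothesis e_gt0 : 0 < e.
Notation A := (2 * e).+1.
Notation cell := (cell M).
Notation state := 'I_(tm_nq M).+1.

(* Variable kinds: the content of a cell, the content of two adjacent cells, two paddings, and dummies. *)
Definition var_kind : finType := (cell + (cell * cell + (bool + 'I_A)))%type.
Notation VX s := (inl s : var_kind).
Notation VY s1 s2 := (inr (inl (s1, s2)) : var_kind).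
Notation VP b := (inr (inr (inl b)) : var_kind).
Notation VD i := (inr (inr (inr i)) : var_kind).

(* Clause kinds: a unit clause padded with all signs of two extra variables,
   no bit after a blank, a guessed cell, and the two halves of the transition rule. *)
Definition clause_kind : finType :=
  ((cell * bool) * (bool * bool) +
   (bool * bool + (unit + (cell * cell + cell * cell * cell))))%type.

Definition blank : cell := (None, None).
Definition bit_cell (b : bool) : cell := (Some b, None).
Definition literal : Type := (var_kind * (nat * nat) * bool)%type.

(* A literal is a variable kind, an offset in time and space, and a sign. *)
Definition literals (c : clause_kind) : seq literal :=
  match c with
  | inl ((s, sg), (b1, b2)) => [:: (VX s, (0, 0), sg); (VP false, (0, 0), b1); (VP true, (0, 0), b2)]
  | inr (inl (b, b')) =>
      [:: (VX blank, (0, 0), false); (VX (bit_cell b), (0, 1), false); (VP false, (0, 0), b')]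
  | inr (inr (inl _)) =>
      [:: (VX blank, (0, 0), true); (VX (bit_cell true), (0, 0), true); (VX (bit_cell false), (0, 0), true)]
  | inr (inr (inr (inl (s1, s2)))) =>
      [:: (VX s1, (0, 0), false); (VX s2, (0, 1), false); (VY s1 s2, (0, 0), true)]
  | inr (inr (inr (inr (s1, s2, s3)))) =>
      [:: (VY s1 s2, (0, 0), false); (VX s3, (0, 2), false); (VX (next_cell s1 s2 s3), (1, 1), true)]
  end.

(** Positions from 3 on are filled with dummies; for [e = 1] there are no such positions. *)
Definition literal_at (c : clause_kind) (i : 'I_A) : literal :=
  nth (VD i, (0, 0), true) (literals c) i.

(** The gadget requires distinct variables within a clause. This is why a unit clause is padded with
    two further variables in all sign patterns instead of repeating its literal. *)
Lemma literal_at_inj c : injective (fun i => (literal_at c i).1).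
Proof.
move=> [i iA] [j jA]; rewrite /literal_at /= => E; apply: val_inj => /=; move: E.
case: c => [[[s sg] [b1 b2]]|[[b b']|[[]|[[s1 s2]|[[s1 s2] s3]]]]];
  case: i iA => [|[|[|i]]] iA; case: j jA => [|[|[|j]]] jA //=; rewrite ?nth_nil //;
  first [by case | by move=> [->]].
Qed.

Definition rejecting (s : cell) : bool :=
  if s.2 is Some q then ~~ (tm_halt q && tm_acc q) else false.

Section Instance.
Variables (x : seq bool) (m W : nat).
Hypothesis W_big : size x + m + 2 <= W.

(** In the middle of [4 * W + 1] cells, the head stays at distance at least [W] from both borders
    for [W] steps, and in that time the unconstrained border cells influence only cells nearer than
    that. *)
Definition origin := 2 * W.
Notation B := (4 * W).+1.
Notation Z2 := ('I_B * 'I_B)%type.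

(** The cell [origin + size x] is left out: it holds the blank that separates the input from the
    certificate. *)
Definition guessed (p : nat) : bool := (origin + size x < p) && (p <= origin + size x + m).
Definition init_sym (p : nat) : option bool :=
  if (origin <= p) && (p < origin + size x) then Some (nth false x (p - origin)) else None.
Definition init_cell (p : nat) : cell :=
  (init_sym p, if p == origin then Some (tm_start M) else None).

Definition guard (c : clause_kind) (t p : nat) : bool :=
  match c with
  | inl ((s, sg), _) =>
      if sg then [&& t == 0, ~~ guessed p & s == init_cell p] else (t == W) && rejecting s
  | inr (inl _) => [&& t == 0, guessed p & guessed p.+1]
  | inr (inr (inl _)) => (t == 0) && guessed p
  | inr (inr (inr (inl _))) => p.+1 < B
  | inr (inr (inr (inr _))) => (t < W) && (p.+2 < B)
  end.

Definition active (c : clause_kind) (z : Z2) : bool := guard c z.1 z.2.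
Definition cell_var (v : var_kind) (t p : nat) : var_kind * Z2 := (v, (inord t, inord p)).
Definition placed (l : literal) (t p : nat) : (var_kind * Z2) * bool :=
  (cell_var l.1.1 (t + l.1.2.1) (p + l.1.2.2), l.2).
Definition place (c : clause_kind) (z : Z2) (i : 'I_A) : (var_kind * Z2) * bool :=
  placed (literal_at c i) z.1 z.2.

(** An active clause only mentions cells inside the window, so the coordinates produced by [inord]
    in [cell_var] are never its default value. *)
Lemma guard_bound c t p i : guard c t p -> t < B -> p < B ->
  t + (literal_at c i).1.2.1 < B /\ p + (literal_at c i).1.2.2 < B.
Proof.
rewrite /literal_at /guard /guessed /origin => G tB pB; move: G.
case: c => [[[s sg] [b1 b2]]|[[b b']|[[]|[[s1 s2]|[[s1 s2] s3]]]]];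
  case: i => [[|[|[|i]]] iA] /=; rewrite ?nth_nil /=; lia.
Qed.

Lemma place_inj c z : active c z -> injective (fun i => (place c z i).1).
Proof.
case: z => t p; rewrite /active /= => G i j; rewrite /place /placed /cell_var /=.
have [it ip] := guard_bound i G (ltn_ord t) (ltn_ord p).
have [jt jp] := guard_bound j G (ltn_ord t) (ltn_ord p).
move=> [Ek /(congr1 val) Et /(congr1 val) Ep]; rewrite /= !inordK // in Et Ep.
apply: (@literal_at_inj c); apply: injective_projections => //=.
by apply: injective_projections; lia.
Qed.

Definition satisfies (asg : var_kind * Z2 -> bool) : Prop := forall c z, active c z ->
  #|[set i | asg (place c z i).1 != (place c z i).2]| <= 2.

Notation holds asg l t p := (asg (placed l t p).1 == (placed l t p).2).

(** If the three proper literals all failed, there would be three false ones already, whatever the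
    values of the dummies. *)
Lemma satisfies_has asg c t p : satisfies asg -> guard c t p -> t < B -> p < B ->
  has (fun l => holds asg l t p) (literals c).
Proof.
move=> sat G tB pB; have := sat c (inord t, inord p).
rewrite /active /= !inordK // => /(_ G); apply: contraTT => /hasPn H; rewrite -ltnNge.
have i3 : 2 < A by lia.
pose S := [set (inord i : 'I_A) | i : 'I_3].
have <- : #|S| = 3.
  rewrite card_imset ?card_ord // => i j /(congr1 val) /=.
  have := ltn_ord i; have := ltn_ord j => j3' i3'.
  by rewrite !inordK; [apply: val_inj | lia | lia].
apply/subset_leq_card/subsetP => _ /imsetP[i _ ->]; rewrite inE.
have iA : i < A by have := ltn_ord i; lia.
have il : i < size (literals c).
  by have := ltn_ord i; case: (c) => [[[s sg] [b1 b2]]|[[b b']|[[]|[[s1 s2]|[[s1 s2] s3]]]]].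
by rewrite /literal_at inordK // (set_nth_default (VX blank, (0, 0), true)) //; apply: H; rewrite mem_nth.
Qed.

(** With true dummies only the first three positions can be false, and one of them is not. *)
Lemma has_satisfies (asg : var_kind * Z2 -> bool) : (forall i t p, asg (cell_var (VD i) t p)) ->
  (forall c t p, guard c t p -> t < B -> p < B -> has (fun l => holds asg l t p) (literals c)) ->
  satisfies asg.
Proof.
move=> dummy H c z G; have := H c z.1 z.2 G (ltn_ord _) (ltn_ord _).
move=> /(has_nthP (VX blank, (0, 0), true))[k kl hk].
have l3 : size (literals c) = 3.
  by case: (c) => [[[s sg] [b1 b2]]|[[b b']|[[]|[[s1 s2]|[[s1 s2] s3]]]]].
have k3 : k < 3 by rewrite -l3.
have i3 : 2 < A by lia.
pose S := [set (inord i : 'I_A) | i : 'I_3].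
have S3 : #|S| <= 3 by apply: leq_trans (leq_imset_card _ _) _; rewrite card_ord.
have kS : inord k \in S by apply/imsetP; exists (Ordinal k3).
have kA : k < A by lia.
rewrite -ltnS; apply: leq_trans S3; apply/proper_card/properP; split; last first.
  exists (inord k) => //; rewrite inE negbK /place /literal_at inordK //.
  by rewrite (set_nth_default (VX blank, (0, 0), true)).
apply/subsetP => i; rewrite inE => Hi; apply/imsetP.
have i3' : i < 3.
  apply: contraR Hi; rewrite -leqNgt /place /literal_at => ige.
  by rewrite nth_default ?l3 //= dummy.
by exists (Ordinal i3') => //; apply: val_inj; rewrite /= inordK.
Qed.
Definition start_cfg (y : seq bool) : state * Z * (Z -> sym) :=
  (tm_start M, 0%Z, tape_of (verifier_input x y)).
Definition history (y : seq bool) (t p : nat) : cell :=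
  cell_at (iter t (gstep (@tm_halt M) (@tm_delta M)) (start_cfg y)) (Z.of_nat p - Z.of_nat origin).
Definition accepts (y : seq bool) : Prop :=
  let c := run W (init_tape M (verifier_input x y)) in halted c /\ tm_acc (c_state c).

Lemma history_next y t p :
  history y t.+1 p.+1 = next_cell (history y t p) (history y t p.+1) (history y t p.+2).
Proof. by rewrite /history iterS next_cellE; congr next_cell; congr cell_at; lia. Qed.

Lemma history0 y p : size y <= m -> p < B -> history y 0 p =
  if guessed p then (nth None (map Some y) (p - origin - size x - 1), None) else init_cell p.
Proof.
move=> ym pB; rewrite /history /= /init_cell /init_sym /guessed.
have E : forall T (a b : T), (if (Z.of_nat p - Z.of_nat origin =? 0)%Z then a else b) = if p == origin then a else b.
  by move=> T a b; case: Z.eqb_spec => ?; case: eqP => ? //; exfalso; lia.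
rewrite {}E /tape_of /verifier_input.
set g := (_ < p) && _; case: Z.ltb_spec => po.
  have -> : g = false by rewrite /g; lia.
  by have -> : (origin <= p) = false by lia.
have {}po : origin <= p by lia.
rewrite po; have -> : Z.to_nat (Z.of_nat p - Z.of_nat origin) = p - origin by lia.
rewrite nth_cat size_map; have [px|px] := ltnP (p - origin) (size x).
  have -> : g = false by rewrite /g; lia.
  rewrite (nth_map false) //.
  by have -> : p < origin + size x by lia.
have -> : (p < origin + size x) = false by lia.
case k: (p - origin - size x) => [|k']; first by have -> : g = false by rewrite /g; lia.
have -> : (p == origin) = false by lia.
rewrite /= subn1 /=; case: (boolP g) => // ng.
by rewrite nth_default // size_map; move: ng; rewrite /g; lia.
Qed.

(** Only the cell under the head can reject, and after [W] steps the head is still inside the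
    window. *)
Lemma accept_history y : accepts y <->
  forall p, p < B -> ~~ rejecting (history y W p).
Proof.
have R := represents_run W (represents_init M (verifier_input x y)).
have hb := head_bound W (start_cfg y).
rewrite /accepts /history; move: R hb; rewrite -/(start_cfg y) /=.
case: (iter W _ _) => [[q h] tp] [cq _ _ _] /= hb.
rewrite /halted cq; split=> [[hq aq] p _|H].
  by rewrite /rejecting /=; case: Z.eqb_spec => // _; rewrite hq aq.
have := H (Z.to_nat (h + Z.of_nat origin)); rewrite /origin /rejecting.
case: Z.eqb_spec => [_|]; last by lia.
by rewrite /= negbK => /(_ ltac:(lia)) /andP[].
Qed.

Lemma accepts_satisfiable y : size y <= m -> accepts y -> exists asg, satisfies asg.
Proof.
move=> ym /accept_history acc.
pose asg (v : var_kind * Z2) : bool :=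
  let: (k, (t, p)) := v in
  match k with
  | inl s => history y t p == s
  | inr (inl (s1, s2)) => (history y t p == s1) && (history y t p.+1 == s2)
  | inr (inr (inl _)) => false
  | inr (inr (inr _)) => true
  end.
exists asg; apply: has_satisfies => // c t p G tB pB.
have gb : forall i, t + (literal_at c i).1.2.1 < B /\ p + (literal_at c i).1.2.2 < B.
  by move=> i; apply: guard_bound.
have asgE v t' p' : t' < B -> p' < B -> asg (cell_var v t' p') = asg (v, (inord t', inord p')) by [].
case: c G gb => [[[s sg] [b1 b2]]|[[b b']|[[]|[[s1 s2]|[[s1 s2] s3]]]]] /= G gb;
  rewrite /placed /cell_var /= ?addn0 ?addn1 ?addn2 ?inordK //; try lia;
  try by move: G; rewrite /guessed /origin; lia.
- case: sg G gb => [/and3P[/eqP-> ng /eqP->]|/andP[/eqP-> rj]] _.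
    by rewrite history0 // (negPf ng) eqxx.
  by rewrite (_ : (_ == s) = false) //; apply/eqP => E; have := acc p pB; rewrite E rj.
- case/and3P: G => /eqP-> g g'; rewrite !history0 ?g ?g' //; last by move: g'; rewrite /guessed /origin; lia.
  rewrite (_ : p.+1 - _ - _ - 1 = (p - origin - size x - 1).+1); last by move: g g'; rewrite /guessed; lia.
  move: (_ - 1) => k; have [ky|yk] := ltnP k (size y); first by rewrite (nth_map false).
  by rewrite [nth _ _ k.+1]nth_default ?orbT // size_map leqW.
- case/andP: G => /eqP-> g; rewrite history0 // g.
  by case: nth => [[]|].
- rewrite history_next.
  case: (eqVneq (history y t p) s1) => [->|//]; case: (eqVneq (history y t p.+1) s2) => [->|//].
  by case: (eqVneq (history y t p.+2) s3) => [->|//]; rewrite eqxx.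
Qed.

(** A cell may carry several contents under [asg]. The certificate is read off the guessed cells,
    and the rules, being implications, then force the contents of its true history to hold row by
    row; further contents do no harm, since the last row only has to avoid rejecting ones. *)
Lemma satisfiable_accepts (asg : var_kind * Z2 -> bool) : satisfies asg ->
  exists2 y, size y <= m & accepts y.
Proof.
move=> sat.
pose val s t p := asg (cell_var (VX s) t p).
(* The signs of the padding are chosen opposite to the values of the two padding variables, so that
   only the proper literal can hold. *)
have unit_pos s p : ~~ guessed p -> s = init_cell p -> p < B -> val s 0 p.
  move=> ng sE pB.
  have := @satisfies_has asg (inl ((s, true), (~~ asg (cell_var (VP false) 0 p), ~~ asg (cell_var (VP true) 0 p)))) 0 p sat.
  rewrite /= ng sE eqxx /placed /= !add0n !addn0 -/(val _ _ _) => /(_ isT isT pB).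
  by rewrite eqb_id; case: (val _ _ _) => //=; case: (asg _); case: (asg _).
have unit_neg s p : rejecting s -> p < B -> ~~ val s W p.
  move=> rs pB.
  have := @satisfies_has asg (inl ((s, false), (~~ asg (cell_var (VP false) W p), ~~ asg (cell_var (VP true) W p)))) W p sat.
  rewrite /= rs eqxx /placed /= !addn0 -/(val _ _ _) => /(_ isT ltac:(lia) pB).
  by case: (val _ _ _) => //=; case: (asg _); case: (asg _).
have guess p : guessed p -> [|| val blank 0 p, val (bit_cell true) 0 p | val (bit_cell false) 0 p].
  move=> g; have pB : p < B by move: g; rewrite /guessed /origin; lia.
  have := @satisfies_has asg (inr (inr (inl tt))) 0 p sat.
  by rewrite /= g /placed /= !addn0 !eqb_id orbF; apply.
have blanks p b : guessed p -> guessed p.+1 -> val blank 0 p -> ~~ val (bit_cell b) 0 p.+1.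
  move=> g g' vb; have pB : p.+1 < B by move: g'; rewrite /guessed /origin; lia.
  have := @satisfies_has asg (inr (inl (b, ~~ asg (cell_var (VP false) 0 p)))) 0 p sat.
  rewrite /= g g' /placed /= !addn0 addn1 -/(val blank 0 p) vb -/(val _ _ _) => /(_ isT isT (ltnW pB)).
  by case: (val _ _ _) => //=; case: (asg _).
have rule s1 s2 s3 t p : t < W -> p.+2 < B -> val s1 t p -> val s2 t p.+1 -> val s3 t p.+2 ->
    val (next_cell s1 s2 s3) t.+1 p.+1.
  move=> tW pB v1 v2 v3.
  have := @satisfies_has asg (inr (inr (inr (inl (s1, s2))))) t p sat.
  rewrite /= /placed /= !addn0 addn1 -/(val s1 t p) v1 -/(val s2 t p.+1) v2 /=.
  move=> /(_ (ltnW pB) ltac:(lia) (ltnW (ltnW pB))); rewrite eqb_id orbF => vy.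
  have := @satisfies_has asg (inr (inr (inr (inr (s1, s2, s3))))) t p sat.
  rewrite /= tW pB /placed /= !addn0 !addn1 addn2 vy -/(val s3 t p.+2) v3 /= eqb_id orbF.
  by apply; lia.
pose first := origin + size x + 1.
(* The certificate ends at the first guessed blank, or has full length [m] if there is none. *)
pose stop := find (fun j => val blank 0 (first + j)) (iota 0 m).
pose y := [seq val (bit_cell true) 0 (first + j) | j <- iota 0 stop].
have stop_m : stop <= m by rewrite -[X in _ <= X](size_iota 0 m) find_size.
have ym : size y <= m by rewrite size_map size_iota.
exists y => //.
(* No bit may follow a blank, and every guessed cell carries a bit or a blank; so blanks propagate
   to the right. *)
have blank_from j : stop <= j -> j < m -> val blank 0 (first + j).
  move=> sj jm; rewrite -(subnKC sj); move: (j - stop) (subnKC sj) => k; elim: k j {sj} jm => [|k IH] j jm kE.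
    have hs : has (fun j => val blank 0 (first + j)) (iota 0 m) by rewrite has_find size_iota; lia.
    by have := nth_find 0 hs; rewrite nth_iota ?addn0 //; lia.
  have g : guessed (first + (stop + k)) by rewrite /guessed /first; lia.
  have g' : guessed (first + (stop + k)).+1 by rewrite /guessed /first; lia.
  have vb := IH (stop + k) ltac:(lia) erefl.
  have := guess _ g'; rewrite (negPf (blanks _ true g g' vb)) (negPf (blanks _ false g g' vb)) !orbF.
  by rewrite -!addnS.
have val0 p : p < B -> val (history y 0 p) 0 p.
  move=> pB; rewrite history0 //; case: ifP => [g|/negbT ng]; last exact: unit_pos.
  pose j := p - origin - size x - 1.
  have pE : p = first + j by move: g; rewrite /guessed /first /j; lia.
  have jm : j < m by move: g; rewrite /guessed /j; lia.
  rewrite -/j; have [js|sj] := ltnP j stop; last first.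
    by rewrite nth_default ?size_map ?size_iota // pE; apply: blank_from.
  rewrite (nth_map false) ?size_map ?size_iota // (nth_map 0) ?size_iota // nth_iota // add0n -pE.
  have nb : val blank 0 p = false.
    by have := before_find 0 js; rewrite nth_iota // add0n -pE.
  have := guess p g; rewrite nb /=.
  by case E: (val (bit_cell true) 0 p) => //=; rewrite -/(bit_cell _) E.
(* The border of the window influences only the cells outside this trapezoid. *)
have valt t : t <= W -> forall p, t <= p -> p + t < B -> val (history y t p) t p.
  elim: t => [|t IH] tW p; first by move=> _; rewrite addn0; apply: val0.
  case: p => // p tp pB; rewrite history_next.
  by apply: rule; try lia; apply: IH; lia.
apply/accept_history => p pB; apply/negP => rj.
have hb := head_bound W (start_cfg y).
have pW : W <= p /\ p + W < B.
  move: rj hb; rewrite /history /=; case: (iter W _ _) => [[q h] tp] /=.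
  by rewrite /rejecting /=; case: Z.eqb_spec => // <- _; rewrite /origin; lia.
case: pW => Wp pW; have := unit_neg _ _ rj pB.
by rewrite valt.
Qed.

Theorem tableau_satisfiable :
  (exists asg, satisfies asg) <-> (exists2 y, size y <= m & accepts y).
Proof.
split=> [[asg]|[y ym]]; [exact: satisfiable_accepts | exact: accepts_satisfiable].
Qed.

End Instance.
End Formula.

(** * The reduction *)

Section Definable.
Implicit Types (F G : seq bool -> (nat -> nat) -> nat) (P Q : seq bool -> (nat -> nat) -> bool).

(** One expression serves all inputs. The assumption that register 0 holds the length of the input
    is provided by the environment in [prog_poly]. *)
Definition definable F : Prop :=
  exists E, forall x rho, rho 0 = size x -> eval x rho E = F x rho.
Definition decidable_expr P : Prop :=
  exists E, forall x rho, rho 0 = size x -> (eval x rho E != 0) = P x rho.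

Lemma def_var i : definable (fun x rho => rho i).
Proof. by exists (EVar i). Qed.

Lemma def_cst c : definable (fun x rho => c).
Proof. by exists (ECst c). Qed.

Lemma def_size : definable (fun x rho => size x).
Proof. by exists (EVar 0) => x rho /=. Qed.

Lemma def_add F G : definable F -> definable G -> definable (fun x rho => F x rho + G x rho).
Proof. by move=> [E HE] [E' HE']; exists (EAdd E E') => x rho H /=; rewrite HE ?HE'. Qed.

Lemma def_succ F : definable F -> definable (fun x rho => (F x rho).+1).
Proof. by move=> [E HE]; exists (EAdd E (ECst 1)) => x rho H /=; rewrite HE ?addn1. Qed.

Lemma def_sub F G : definable F -> definable G -> definable (fun x rho => F x rho - G x rho).
Proof. by move=> [E HE] [E' HE']; exists (ESub E E') => x rho H /=; rewrite HE ?HE'. Qed.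

Lemma def_mul F G : definable F -> definable G -> definable (fun x rho => F x rho * G x rho).
Proof. by move=> [E HE] [E' HE']; exists (EMul E E') => x rho H /=; rewrite HE ?HE'. Qed.

Lemma def_exp F d : definable F -> definable (fun x rho => F x rho ^ d).
Proof.
move=> DF; elim: d => [|d IH]; first exact: def_cst.
have [E HE] := def_mul DF IH; exists E => x rho H; by rewrite HE // expnS.
Qed.

Lemma dec_ext P Q : (forall x rho, P x rho = Q x rho) -> decidable_expr Q -> decidable_expr P.
Proof. by move=> PQ [E HE]; exists E => x rho H; rewrite PQ HE. Qed.

Lemma dec_cst b : decidable_expr (fun x rho => b).
Proof. by exists (ECst b) => x rho _; case: b. Qed.

Lemma dec_leq F G : definable F -> definable G -> decidable_expr (fun x rho => F x rho <= G x rho).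
Proof.
by move=> [E HE] [E' HE']; exists (ESub (ECst 1) (ESub E E')) => x rho H /=; rewrite HE ?HE' //; lia.
Qed.

Lemma dec_not P : decidable_expr P -> decidable_expr (fun x rho => ~~ P x rho).
Proof.
by move=> [E HE]; exists (ESub (ECst 1) E) => x rho H /=; rewrite -HE //; lia.
Qed.

Lemma dec_and P Q : decidable_expr P -> decidable_expr Q -> decidable_expr (fun x rho => P x rho && Q x rho).
Proof.
by move=> [E HE] [E' HE']; exists (EMul E E') => x rho H /=; rewrite -HE -?HE' // muln_eq0 negb_or.
Qed.

Lemma dec_or P Q : decidable_expr P -> decidable_expr Q -> decidable_expr (fun x rho => P x rho || Q x rho).
Proof.
by move=> [E HE] [E' HE']; exists (EAdd E E') => x rho H /=; rewrite -HE -?HE' // addn_eq0 negb_and.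
Qed.

Lemma dec_eq F G : definable F -> definable G -> decidable_expr (fun x rho => F x rho == G x rho).
Proof.
move=> DF DG; apply: dec_ext (dec_and (dec_leq DF DG) (dec_leq DG DF)) => x rho.
exact: eqn_leq.
Qed.

Lemma dec_bit F b : definable F -> decidable_expr (fun x rho => nth false x (F x rho) == b).
Proof.
move=> [E HE]; have D : decidable_expr (fun x rho => nth false x (F x rho)).
  by exists (EBit E) => x rho H /=; rewrite HE //; case: nth.
case: b; last by apply: dec_ext (dec_not D) => x rho; case: nth.
by apply: dec_ext D => x rho; case: nth.
Qed.
End Definable.

Ltac def_tac := repeat first
  [ exact: def_var | exact: def_cst | exact: def_size | exact: dec_cst
  | apply: def_succ | apply: def_add | apply: def_sub | apply: def_mul | apply: def_exp
  | apply: dec_and | apply: dec_or | apply: dec_not | apply: dec_bit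
  | apply: dec_eq | apply: dec_leq | assumption ].

(** * Printing an adjacency matrix by nested loops *)

Lemma map_enum_val (T : finType) : [seq enum_val i | i <- enum 'I_#|T|] = enum T.
Proof.
have [x0 _|T0] := pickP (fun _ : T => true); last first.
  have c0 : #|T| = 0 by apply: eq_card0 => y; have /= := T0 y.
  have -> : enum T = [::] by apply/eqP; rewrite -size_eq0 -cardE c0.
  by apply/eqP; rewrite -size_eq0 size_map size_enum_ord c0.
apply: (@eq_from_nth _ x0); first by rewrite size_map size_enum_ord cardE.
move=> i; rewrite size_map size_enum_ord => iT.
rewrite (nth_map (Ordinal iT)) ?size_enum_ord //.
by rewrite (enum_val_nth x0) nth_enum_ord.
Qed.

(** The enumeration of a product is lexicographic, so nested loops visit the vertices in the order
    in which the encoding lists them. *)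
Lemma enum_prodE (T1 T2 : finType) : enum {: T1 * T2} = [seq (x, y) | x <- enum T1, y <- enum T2].
Proof. by rewrite [LHS]enumT unlock. Qed.

Definition pseqs (s : seq prog) : prog := foldr PSeq PSkip s.

Lemma sem_pseqs x rho d s : sem x rho d (pseqs s) = flatten [seq sem x rho d p | p <- s].
Proof. by elim: s => //= p s ->. Qed.

Lemma sem_for x rho d E p N (f : nat -> seq bool) : eval x rho E = N ->
  (forall v, v < N -> sem x (loop_env rho d N v) d.+2 p = f v) ->
  sem x rho d (PFor E p) = flatten [seq f (val i) | i <- enum 'I_N].
Proof.
move=> EN H; rewrite /= EN (map_comp f) val_enum_ord; congr flatten.
by apply/eq_in_map => v; rewrite mem_iota => /andP[_ vN]; apply: H.
Qed.

Lemma sem_ones x rho d E N : eval x rho E = N -> sem x rho d (PFor E (POut (ECst 1))) = nseq N true.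
Proof.
by move=> EN; rewrite /= EN; elim: N 0 {EN} => //= N IH a; rewrite IH.
Qed.

Lemma flatten_pairs (T1 T2 S : Type) (G : T1 * T2 -> seq S) s1 s2 :
  flatten [seq G u | u <- [seq (x, y) | x <- s1, y <- s2]] =
  flatten [seq flatten [seq G (x, y) | y <- s2] | x <- s1].
Proof. by elim: s1 => //= x s1 IH; rewrite map_cat flatten_cat IH -map_comp. Qed.

Lemma flatten_singles (T S : Type) (f : T -> S) s : flatten [seq [:: f x] | x <- s] = [seq f x | x <- s].
Proof. by elim: s => //= x s ->. Qed.

Lemma graph_of_bits (V : finType) (r : rel V) (r_sym : symmetric r) (r_irr : irreflexive r) :
  [seq @gadj (graph_of r_sym r_irr) i j | i <- enum 'I_(gv (graph_of r_sym r_irr)),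
                                         j <- enum 'I_(gv (graph_of r_sym r_irr))] =
  flatten [seq flatten [seq [:: r u v] | v <- enum V] | u <- enum V].
Proof.
rewrite -(map_enum_val V); congr flatten; rewrite -[RHS]map_comp; apply: eq_map => i /=.
by rewrite flatten_singles -[RHS]map_comp.
Qed.

(** Kinds do not depend on the input, so the iteration over them is unrolled, each pair having its
    own expression; only the coordinates are looped over. Entered at depth 1, the four nested loops
    have their counters in registers 2, 4, 6 and 8. *)
Definition grid_prog (K : finType) (EB : expr) (E : K -> K -> expr) : prog :=
  pseqs [seq PFor EB (PFor EB (pseqs [seq PFor EB (PFor EB (POut (E k k'))) | k' <- enum K])) | k <- enum K].

Lemma sem_grid (K : finType) x rho (EB : expr) (E : K -> K -> expr) (N : nat)
    (b : K -> nat -> nat -> K -> nat -> nat -> bool) (r : rel (K * ('I_N * 'I_N))) :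
  (forall rho', rho' 0 = rho 0 -> eval x rho' EB = N) ->
  (forall k k' rho', rho' 0 = rho 0 ->
     (eval x rho' (E k k') != 0) = b k (rho' 2) (rho' 4) k' (rho' 6) (rho' 8)) ->
  (forall k z k' z', r (k, z) (k', z') = b k z.1 z.2 k' z'.1 z'.2) ->
  sem x rho 1 (grid_prog EB E) =
  flatten [seq flatten [seq [:: r u v] | v <- enum {: K * ('I_N * 'I_N)}] | u <- enum {: K * ('I_N * 'I_N)}].
Proof.
move=> HB HE rE; rewrite sem_pseqs -map_comp enum_prodE flatten_pairs; congr flatten; apply: eq_map => k.
rewrite enum_prodE flatten_pairs.
pose bits t p := flatten [seq flatten [seq flatten [seq
  [:: b k t p k' (val t') (val p')] | p' <- enum 'I_N] | t' <- enum 'I_N] | k' <- enum K].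
rewrite [LHS](sem_for (N := N) (f := fun t => flatten [seq bits t (val p) | p <- enum 'I_N])); last first.
- move=> t tB; apply: sem_for; first by apply: HB.
  move=> p pB; rewrite sem_pseqs -map_comp; congr flatten; apply: eq_map => k'.
  apply: (sem_for (N := N) (f := fun t' => flatten [seq [:: b k t p k' t' (val p')] | p' <- enum 'I_N])).
    by apply: HB.
  move=> t' tB'; apply: (sem_for (f := fun p' => [:: b k t p k' t' p'])); first by apply: HB.
  by move=> p' pB'; rewrite /= HE.
- by apply: HB.
congr flatten; apply: eq_map => t; congr flatten; apply: eq_map => p; rewrite /bits.
rewrite ?enum_prodE flatten_pairs; congr flatten; apply: eq_map => k'.
rewrite ?enum_prodE flatten_pairs; congr flatten; apply: eq_map => t'; congr flatten; apply: eq_map => p'.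
by rewrite rE.
Qed.

Lemma sem_seq x rho d p q : sem x rho d (PSeq p q) = sem x rho d p ++ sem x rho d q.
Proof. by []. Qed.

(** * The reduction as a program *)

Section Encoding.
Variables (M : TM) (e c d : nat).
Hypothesis e_gt0 : 0 < e.
Notation A := (2 * e).+1.

Definition guess_len (n : nat) : nat := poly_bound c d n.
(** The first summand bounds the running time of the verifier with a certificate of maximal length;
    the others make room for the initial tape. *)
Definition horizon (n : nat) : nat := poly_bound c d (n + guess_len n) + n + guess_len n + 2.
Notation B n := (4 * horizon n).+1.

Lemma horizon_big n : n + guess_len n + 2 <= horizon n.
Proof. by rewrite /horizon; lia. Qed.

Lemma def_horizon : definable (fun x rho => horizon (size x)).
Proof. by rewrite /horizon /guess_len /poly_bound; def_tac. Qed.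

Lemma def_width : definable (fun x rho => B (size x)).
Proof. by have DH := def_horizon; def_tac. Qed.

Lemma dec_guard (k : clause_kind M) i j : decidable_expr (fun x rho =>
  guard x (guess_len (size x)) (horizon (size x)) k (rho i) (rho j)).
Proof.
have DH := def_horizon; have DB := def_width.
have DG : definable (fun x rho => guess_len (size x)) by rewrite /guess_len /poly_bound; def_tac.
have DS (f : nat -> nat) : definable (fun x rho => f (rho j)) -> 
  decidable_expr (fun x rho => guessed x (guess_len (size x)) (horizon (size x)) (f (rho j))).
  by move=> Df; rewrite /guessed /origin; def_tac.
case: k => [[[[a h] sg] [b1 b2]]|[[b b']|[[]|[[s1 s2]|[[s1 s2] s3]]]]]; rewrite /guard.
- case: sg; last by def_tac.
  apply: dec_and; first by def_tac.
  apply: dec_and; first by apply: dec_not; apply: (DS id); def_tac.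
  pose inside (x : seq bool) (rho : nat -> nat) :=
    (origin (horizon (size x)) <= rho j) && (rho j < origin (horizon (size x)) + size x).
  have Din : decidable_expr inside by rewrite /inside /origin; def_tac.
  have Dor : decidable_expr (fun x rho => rho j == origin (horizon (size x))) by rewrite /origin; def_tac.
  apply: (@dec_ext _ (fun x rho =>
     (if a is Some b then inside x rho && (nth false x (rho j - origin (horizon (size x))) == b) else ~~ inside x rho) &&
     (if h is Some q then (q == tm_start M) && (rho j == origin (horizon (size x))) else rho j != origin (horizon (size x))))).
    move=> x rho; rewrite /init_cell /init_sym -/(inside x rho).
    congr (_ && _) => /=.
      by case: (inside x rho); case: a => [b|] //=; apply: eq_sym.
    by case: (rho j == _); case: h => [q|] //=; rewrite ?andbT ?andbF.
  apply: dec_and.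
    by case: a => [b|]; [apply: dec_and => //; rewrite /origin; def_tac | apply: dec_not].
  by case: h => [q|]; [apply: dec_and => //; exact: dec_cst | apply: dec_not].
- by apply: dec_and; [def_tac | apply: dec_and; [apply: (DS id); def_tac | apply: (DS succn); def_tac]].
- by apply: dec_and; [def_tac | apply: (DS id); def_tac].
- by def_tac.
- by def_tac.
Qed.
Notation kinds := (kind e (var_kind M e) (clause_kind M)).

(** This is [half_adj] with the coordinates as numbers. Literals are compared only under the guard,
    where by [guard_bound] the addition of offsets agrees with [inord]. *)
Definition half_nat (x : seq bool) (k : kinds) (t p : nat) (k' : kinds) (t' p' : nat) : bool :=
  match k, k' with
  | inl (v, s), inl (v', s') => [&& v == v', t == t', p == p' & s != s']
  | inl (v, s), inr (c, m, Some (i, j)) =>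
      let l := literal_at c i in
      [&& j == 0 :> nat, guard x (guess_len (size x)) (horizon (size x)) c t' p', l.1.1 == v, l.2 == s,
          t' + l.1.2.1 == t & p' + l.1.2.2 == p]
  | inr (c, m, Some (i, j)), inr (c', m', Some (i', j')) =>
      [&& c == c', m == m', t == t', p == p', i == i' & j.+1 == j']
  | inr (c, m, Some (i, j)), inr (c', m', None) =>
      [&& c == c', m == m', t == t', p == p' & j.+1 == e]
  | _, _ => false
  end.

Lemma dec_half k k' i j i' j' :
  decidable_expr (fun x rho => half_nat x k (rho i) (rho j) k' (rho i') (rho j')).
Proof.
case: k k' => [[v s]|[[c0 m] [[a b]|]]] [[v' s']|[[c0' m'] [[a' b']|]]]; rewrite /half_nat; try by def_tac.
by have := dec_guard c0' i' j' => ?; def_tac.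
Qed.

Section Input.
Variable x : seq bool.
Notation n := (size x).
Notation Z2 := ('I_(B n) * 'I_(B n))%type.
Notation act := (@active M x (guess_len n) (horizon n)).
Notation plc := (@place M e (horizon n)).
Notation vertex := (vert e (var_kind M e) (clause_kind M) Z2).

Lemma half_natE (k k' : kinds) (z z' : Z2) :
  half_adj act plc ((k, z) : vertex) ((k', z') : vertex) = half_nat x k z.1 z.2 k' z'.1 z'.2.
Proof.
case: z z' => [t p] [t' p'].
have E (u v : 'I_(B n) * 'I_(B n)) : (u == v) = (u.1 == v.1 :> nat) && (u.2 == v.2 :> nat) by [].
case: k k' => [[v s]|[[c0 m] [[a b]|]]] [[v' s']|[[c0' m'] [[a' b']|]]] //=;
  rewrite ?E -?andbA //.
case: (b' == 0 :> nat) => //=; rewrite /active /=; case G: (guard _ _ _ _ _ _) => //=.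
have [bt bp] := guard_bound e_gt0 (horizon_big n) a' G (ltn_ord _) (ltn_ord _).
rewrite /place /placed /cell_var /= -[_ == _]/((((_ == _) && _)) && (_ == _)) /= E /= !inordK //.
by rewrite -!andbA; do !bool_congr.
Qed.

Lemma input_wcol : reflect
  (exists2 y, size y <= guess_len n & accepts M x (horizon n) y)
  (wcol e.+2 (gadget_graph act plc) <= (2 * e).+3).
Proof.
have inj := @place_inj M e e_gt0 _ _ _ (horizon_big n); have sat := tableau_satisfiable M e_gt0 (horizon_big n).
by apply: (iffP idP) => [/(gadget_wcolP e_gt0 inj)/sat | /sat/(gadget_wcolP e_gt0 inj)].
Qed.
End Input.
Definition adj_nat x k t p k' t' p' : bool :=
  half_nat x k t p k' t' p' || half_nat x k' t' p' k t p.

(** The kinds form a finite type, so one expression per pair of them can be chosen uniformly in the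
    input. *)
Lemma adj_exprs : exists E : kinds -> kinds -> expr, forall k k' x rho, rho 0 = size x ->
  (eval x rho (E k k') != 0) = adj_nat x k (rho 2) (rho 4) k' (rho 6) (rho 8).
Proof.
apply: (@fin_all_exists _ (fun=> kinds -> expr) (fun k E => forall k' x rho, rho 0 = size x ->
  (eval x rho (E k') != 0) = adj_nat x k (rho 2) (rho 4) k' (rho 6) (rho 8))) => k.
apply: (@fin_all_exists _ (fun=> expr)
  (fun k' E => forall x rho, rho 0 = size x -> (eval x rho E != 0) = adj_nat x k (rho 2) (rho 4) k' (rho 6) (rho 8))) => k'.
by apply: dec_or; apply: dec_half.
Qed.

Lemma reduction_prog : exists p, forall x,
  enc_inst (gadget_graph (@active M x (guess_len (size x)) (horizon (size x)))
                         (@place M e (horizon (size x)))) (2 * e).+3 =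
  sem x (rset (fun=> 0) 0 (size x)) 1 p.
Proof.
have [EB HB] := def_width; have [E HE] := adj_exprs.
exists (PSeq (PFor (ECst (2 * e).+3) (POut (ECst 1))) (PSeq (POut (ECst 0))
  (PSeq (PFor (EMul (ECst #|kinds|) (EMul EB EB)) (POut (ECst 1))) (PSeq (POut (ECst 0))
  (grid_prog EB E))))) => x.
set rho := rset _ 0 _; have rho0 : rho 0 = size x by [].
rewrite /enc_inst /enc_graph graph_of_bits !sem_seq.
rewrite (@sem_ones _ _ _ _ (2 * e).+3) // (@sem_ones _ _ _ _ (#|kinds| * (B (size x) * B (size x)))); last first.
  by rewrite [LHS]/= HB.
rewrite (@sem_grid _ _ _ _ _ (B (size x)) (adj_nat x)
  (adj (@active M x (guess_len (size x)) (horizon (size x))) (@place M e (horizon (size x))))).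
- congr (_ ++ _ :: _ ++ _ :: _); congr nseq.
  transitivity #|{: kinds * ('I_(B (size x)) * 'I_(B (size x)))}|; first by [].
  by rewrite card_prod card_prod card_ord.
- by move=> rho' rE; apply: HB.
- by move=> k k' rho' rE; apply: HE.
- by move=> k z k' z'; rewrite /adj !half_natE.
Qed.
End Encoding.

(** Membership in the language speaks of some graph with the given code, which need not be the
    constructed one. The code determines the size and the adjacency, and [wcol] depends on nothing
    else. *)
Lemma wcol_gadj r (G G' : graph) (k : nat) : enc_inst G k = enc_inst G' k -> wcol r G = wcol r G'.
Proof.
have nseq_inj a b s s' : nseq a true ++ false :: s = nseq b true ++ false :: s' -> a = b /\ s = s'.
  by elim: a b => [|a IH] [|b] //= [] // /IH[-> ->].
rewrite /enc_inst => /nseq_inj[_] /nseq_inj[].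
case: G G' => [g a sa ia] [g' a' sa' ia'] /= gg; subst g' => H.
have aE : a = a'.
  apply: functional_extensionality => i; apply: functional_extensionality => j.
  pose pairs := [seq (i, j) | i <- enum 'I_g, j <- enum 'I_g].
  have: map (fun u => a u.1 u.2) pairs = map (fun u => a' u.1 u.2) pairs by rewrite !map_allpairs.
  move/eq_in_map => /(_ (i, j)); apply.
  by apply/allpairsP; exists (i, j); rewrite !mem_enum.
by subst a'.
Qed.

Theorem theorem3p10 (r : nat) : 3 <= r ->
  para_NP_hard (weak_r_orderable r) /\
  NP_hard (slice_lang (weak_r_orderable r) (2 * r - 1)).
Proof.
move=> r3; suff H : NP_hard (slice_lang (weak_r_orderable r) (2 * r - 1)) by split=> //; exists (2 * r - 1).
move=> L [M [c [d [time_M L_M]]]].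
(* The assumption [3 <= r] gives every arm at least one inner vertex. *)
have [e e0 rE] : exists2 e, 0 < e & r = e.+2 by exists (r - 2); lia.
have kE : 2 * r - 1 = (2 * e).+3 by lia.
have [p pE] := @reduction_prog M e c d e0.
exists (fun x => sem x (rset (fun=> 0) 0 (size x)) 1 p); split; first by apply: prog_poly.
move=> x; rewrite -pE kE rE.
have acc : L x <-> exists2 y, size y <= guess_len c d (size x) & accepts M x (horizon c d (size x)) y.
  (* The definition of NP allows acceptance at any time, whereas the tableau inspects row [horizon];
     as the verifier has halted by then, both see the same configuration. *)
  have haltW y : size y <= guess_len c d (size x) ->
      halted (run (horizon c d (size x)) (init_tape M (verifier_input x y))).
    move=> ym; have [t [tt [ht _]]] : exists t, t <= horizon c d (size x) /\
        halted (run t (init_tape M (verifier_input x y))) /\ True.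
      have [t [tt ht]] := time_M x y; exists t; split=> //; apply: leq_trans tt _.
      apply: (@leq_trans (poly_bound c d (size x + guess_len c d (size x)))); last first.
        by rewrite /horizon; lia.
      by rewrite /poly_bound leq_add2r leq_mul2l leq_expl ?orbT // leq_add2l.
    by rewrite -(subnKC tt) run_halted.
  rewrite L_M; split=> [[y [ym [t [ht at_]]]]|[y ym [hW aW]]].
    by exists y => //; rewrite /accepts; have hW := haltW y ym; rewrite -(run_halted_eq ht hW).
  by exists y; split=> //; exists (horizon c d (size x)).
rewrite acc; split=> [H|[G [GE wG]]].
  by eexists; split; [reflexivity | apply/(@input_wcol M e c d e0)].
by apply/(@input_wcol M e c d e0); rewrite (wcol_gadj _ GE).
Qed.
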